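(* Let $\lambda>0$ and $\alpha\in(0,1)$, and let $N^\alpha(t)$, $t\ge0$, be the space-fractional Poisson process (defined in the context). Let $k\ge 1$, $1\le r\le k$, and let $l_1,\dots,l_r\ge 1$ be integers with $\sum_{j=1}^r l_j=k$. Let $\tau_j^{l_j}$ denote the instant of the $j$-th upward jump in $[0,t]$, this jump having height $l_j$, where $r$ is the number of jumps in $[0,t]$. Then, for $0<t_1<\dots<t_r<t$, $$\Pr\Bigl\{\bigcap_{j=1}^r\{\tau_j^{l_j}\in dt_j\}\,\Big|\,N^\alpha(t)=k\Bigr\}=\frac{k!\,\bigl(\lambda^\alpha\Gamma(\alpha+1)\bigr)^r(-1)^{k+r}\prod_{j=1}^r\dfrac{dt_j}{l_j!\,\Gamma(\alpha+1-l_j)}}{\sum_{n=1}^k c_{n,k}\,t^n},$$ where the coefficients $c_{n,k}$ are those in the representation $$\Pr\{N^\alpha(t)=k\}=\frac{e^{-\lambda^\alpha t}}{k!}\sum_{n=1}^k c_{n,k}\,t^n .$$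
   Context: The space-fractional Poisson process $N^\alpha$ is the non-negative integer-valued process with $N^\alpha(0)=0$, non-decreasing right-continuous paths, and independent and stationary increments, such that as $dt\downarrow0$, with $N^\alpha[t,t+dt)$ the increment over $[t,t+dt)$, $$\Pr\{N^\alpha[t,t+dt)=k\}=\begin{cases} dt\,\dfrac{\lambda^k}{k!}\displaystyle\int_0^\infty e^{-\lambda s}s^k\,\nu(ds)+o(dt), & k\ge 1,\\[2mm] 1-dt\displaystyle\int_0^\infty(1-e^{-\lambda s})\,\nu(ds)+o(dt), & k=0,\end{cases}\qquad \nu(ds)=\frac{\alpha s^{-\alpha-1}}{\Gamma(1-\alpha)}\,ds,$$ so that $\int_0^\infty(1-e^{-\lambda s})\nu(ds)=\lambda^\alpha$. Its state probabilities are $\Pr\{N^\alpha(t)=k\}=\frac{(-1)^k}{k!}\frac{d^k}{du^k}e^{-t\lambda^\alpha u^\alpha}\big|_{u=1}$, and the $c_{n,k}$ (depending on $\alpha,\lambda$ but not on $t$) are obtained by carrying out these derivatives. The displayed identity means: for every Borel subset $A$ of $\{0<t_1<\dots<t_r<t\}$, the conditional probability given $N^\alpha(t)=k$ that there are exactly $r$ jumps in $[0,t]$, with successive heights $l_1,\dots,l_r$ and successive times $(\tau_1,\dots,\tau_r)\in A$, is the integral over $A$ of the stated density with respect to $dt_1\cdots dt_r$. *)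

(* Defs.v *)
(* MathComp-Analysis, over an arbitrary [R : realType]. *)
From HB Require Import structures.
From mathcomp Require Import all_boot all_order all_algebra.
From mathcomp Require Import all_classical all_reals all_analysis.

Set Implicit Arguments.
Unset Strict Implicit.
Unset Printing Implicit Defensive.

Import Order.TTheory GRing.Theory Num.Theory.
Import numFieldNormedType.Exports.

Local Open Scope classical_set_scope.
Local Open Scope ring_scope.

Definition euler_integral (R : realType) (x : R) : R :=
  \int[lebesgue_measure]_(s in `]0%R, +oo[) (s `^ (x - 1) * expR (- s)).

(* For [x <= 0] the functional equation is used [n] times, with [n] such that
   [0 < x + n]: Gamma(x) = Gamma(x + n) / (x (x + 1) ... (x + n - 1)).
   At the poles 0, -1, -2, ... the value is the junk value 0. *)
Definition Gamma (R : realType) (x : R) : R :=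
  if 0 < x then euler_integral x
  else let n := (Num.truncn `|x|).+1 in
       euler_integral (x + n%:R) / \prod_(i < n) (x + i%:R).

(* Integral of [g] over ]0, +oo[ against
   nu(ds) = alpha s^(- alpha - 1) / Gamma(1 - alpha) ds. *)
Definition levy_integral (R : realType) (alpha : R) (g : R -> R) : R :=
  \int[lebesgue_measure]_(s in `]0%R, +oo[)
    (g s * (alpha * s `^ (- alpha - 1) / Gamma (1 - alpha))).

Section Process.
Context (R : realType) (d : measure_display) (Omega : measurableType d).
Variable P : probability Omega R.
Implicit Types (N : R -> Omega -> nat) (B : set nat).

(* Paths are non-decreasing on [0, +oo[, so for [0 <= s <= t] the subtraction
   on [nat] is the genuine one. *)
Definition incr N (s t : R) (w : Omega) : nat := (N t w - N s w)%N.

(* Mutual independence of the increments over consecutive intervals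
   ]s_0, s_1], ..., ]s_(n-1), s_n]; subfamilies are covered by [B i := setT]. *)
Definition independent_increments N : Prop :=
  forall (n : nat) (s : nat -> R) (B : nat -> set nat),
    0 <= s 0%N -> (forall i, (i < n)%N -> s i <= s i.+1) ->
    P [set w | forall i, (i < n)%N -> B i (incr N (s i) (s i.+1) w)] =
    (\prod_(i < n) P [set w | B i (incr N (s i) (s i.+1) w)])%E.

Definition stationary_increments N : Prop :=
  forall (s h : R) B, 0 <= s -> 0 <= h ->
    P [set w | B (incr N s (s + h) w)] = P [set w | B (incr N 0 h w)].

(* Only times [t >= 0] are meaningful; [N t] is unconstrained for [t < 0]. *)
Record space_fractional_poisson (alpha lambda : R) N : Prop := {
  sfp_measurable : forall t : R, 0 <= t -> measurable_fun setT (N t) ;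
  sfp_start : forall w, N 0 w = 0%N ;
  sfp_nondecreasing : forall w (s t : R), 0 <= s -> s <= t -> (N s w <= N t w)%N ;
  sfp_right_continuous : forall w (t : R), 0 <= t ->
    ((N u w)%:R : R) @[u --> t^'+] --> ((N t w)%:R : R) ;
  sfp_independent : independent_increments N ;
  sfp_stationary : stationary_increments N ;
  sfp_jump : forall (t : R) (k : nat), 0 <= t -> (1 <= k)%N ->
    (fun dt : R => fine (P [set w | incr N t (t + dt) w = k])
       - dt * (lambda ^+ k / k`!%:R
               * levy_integral alpha (fun s => expR (- (lambda * s)) * s ^+ k)))
    =o_ (0^'+) (fun dt : R => dt) ;
  sfp_no_jump : forall t : R, 0 <= t ->
    (fun dt : R => fine (P [set w | incr N t (t + dt) w = 0%N])
       - (1 - dt * levy_integral alpha (fun s => 1 - expR (- (lambda * s)))))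
    =o_ (0^'+) (fun dt : R => dt)
}.

Definition cond_prob (E F : set Omega) : R :=
  fine (P (E `&` F)) / fine (P F).

End Process.

(* Carrying out the derivatives in
     Pr{N(t) = k} = (-1)^k / k! (d/du)^k exp(- t lambda^alpha u^alpha) |_(u = 1)
   gives exp(- lambda^alpha t) / k! times the following polynomial in [t]. *)
Definition state_poly (R : realType) (alpha lambda : R) (k : nat) (t : R) : R :=
  expR (lambda `^ alpha * t) *
  ((-1) ^+ k * derive1n k (fun u : R =>
                 expR (- (t * lambda `^ alpha * u `^ alpha))) 1).

(* [c_(n,k)], the coefficient of [t^n] in [state_poly alpha lambda k t], read
   off as a Taylor coefficient at [t = 0]. *)
Definition state_coef (R : realType) (alpha lambda : R) (n k : nat) : R :=
  derive1n n (state_poly alpha lambda k) 0 / n`!%:R.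

(* f(s) - f(s-), for [s > 0]. *)
Definition jump_height (R : realType) (f : R -> nat) (s : R) : R :=
  (f s)%:R - lim (((f u)%:R : R) @[u --> s^'-]).

(* The jumps of [f] in [[0, t]] (time 0, the origin of the path, is not a jump
   time) are exactly [r] in number, with successive times [tau] and successive
   heights [l]. *)
Definition jumps_are (R : realType) (f : R -> nat) (t : R) (r : nat)
    (l : 'I_r -> nat) (tau : r.-tuple R) : Prop :=
  [/\ forall i j : 'I_r, (i < j)%N -> tnth tau i < tnth tau j,
      forall j : 'I_r, 0 < tnth tau j <= t,
      forall j : 'I_r, jump_height f (tnth tau j) = (l j)%:R
    & forall s : R, 0 < s <= t -> jump_height f s != 0 ->
        exists j : 'I_r, s = tnth tau j].

Definition simplex (R : realType) (r : nat) (t : R) : set (r.-tuple R) :=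
  [set tau | (forall i j : 'I_r, (i < j)%N -> tnth tau i < tnth tau j) /\
             (forall j : 'I_r, 0 < tnth tau j < t)].

(* Integral with respect to dt_1 ... dt_r, as an iterated Lebesgue integral;
   by Tonelli it is the integral against r-dimensional Lebesgue measure for
   measurable non-negative integrands. *)
Fixpoint iter_integral (R : realType) (r : nat) :
    (r.-tuple R -> \bar R) -> \bar R :=
  match r with
  | 0 => fun F => F [tuple]
  | r'.+1 => fun F =>
      (\int[lebesgue_measure]_x iter_integral (fun v => F (cons_tuple x v)))%E
  end.

(* Main.v *)
Require Import Defs.
From HB Require Import structures.
From mathcomp Require Import all_boot all_order all_algebra.
From mathcomp Require Import all_classical all_reals all_analysis.
From mathcomp Require Import measurable_realfun.
From mathcomp Require Import ring lra.
Set Implicit Arguments.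
Unset Strict Implicit.
Unset Printing Implicit Defensive.
Import Order.TTheory GRing.Theory Num.Theory.
Import numFieldNormedType.Exports.
Local Open Scope classical_set_scope.
Local Open Scope ring_scope.

(** Write [m = lambda^alpha]. The Levy integrals are Gamma integrals
    ([levy_integral_jump], [levy_integral_total]), and they show that jumps of height [l]
    occur at rate [m * sibuya alpha l], for a total rate [m], where the numbers
    [sibuya alpha l = (-1)^(l+1) binom(alpha, l)] are also quotients of Gamma values
    ([sibuya_Gamma]). The process is therefore compound Poisson: its jump times are
    uniform given their number, independently of the heights.

    Cut the time interval from [0] to [t] into equal cells of length [h]. Increments over
    the cells are independent, vanish with probability [exp (- m h)], and equal [l]
    with probability [m * sibuya alpha l * h + o(h)]. A prescription of [r] cells and of
    their increments [l_1, ..., l_r], all other cells being empty, thus has probability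
    close to [exp (- m t) * prod_j (m * sibuya alpha l_j)] times the volume [h^r] of the
    product of these cells ([pattern_event_prob]). On a grid fine enough for a given path
    the increments over the cells show exactly its jumps ([jumps_near_cell_pattern]), so by
    dominated convergence the jump times have that constant density on the simplex. This is
    obtained for orthants ([orthant_law]) and extended to Borel sets by the pi-lambda
    theorem ([jump_law]); [tuple_volume] is the iterated integral seen as a measure.

    For the law of the state, the generating function of an increment over one cell is
    raised to the number of cells ([state_law]): with [B] the Sibuya series, the
    probability of the state [k] is [exp (- m t)] times the sum over [n] of
    [(m t)^n / n!] times the coefficient of [z^k] in [B^n]. The derivatives that define
    [state_coef] produce the same numbers, because the recurrence that they satisfy
    expresses the differential equation [(1 - z) B' = alpha (1 - B)] ([deriv_coefS],
    [state_sumE]). Dividing the two laws gives the conditional density, as the heights of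
    the jumps add up to the state ([jumps_are_total]). *)

(** * Integrals over the half-line *)

Section HalfLine.
Context {R : realType}.
Notation mu := (@lebesgue_measure R).

Lemma bigcup_segment_0y (c : R) : 0 < c ->
  \bigcup_n `[c / n.+1%:R, c * n.+1%:R]%classic = `]0, +oo[%classic :> set R.
Proof.
move=> c0; apply/seteqP; split=> [x [n _] /=|x /=].
  rewrite !in_itv/= andbT => /andP[cx _]; apply: lt_le_trans cx.
  by rewrite divr_gt0.
rewrite in_itv/= andbT => x0.
pose n := (Num.truncn (c / x) + Num.truncn (x / c))%N.
have h1 : c / x < n.+1%:R.
  apply: (lt_le_trans (truncnS_gt _)).
  by rewrite ler_nat ltnS leq_addr.
have h2 : x / c < n.+1%:R.
  apply: (lt_le_trans (truncnS_gt _)).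
  by rewrite ler_nat ltnS leq_addl.
exists n => //=; rewrite in_itv/=; apply/andP; split.
  by rewrite ler_pdivrMr// mulrC -ler_pdivrMr// ltW.
by rewrite mulrC -ler_pdivrMr// ltW.
Qed.

Lemma cvg_integral_segment_0y (c : R) (f : R -> R) : 0 < c ->
  (forall x : R, 0 < x -> 0 <= f x) -> {in `]0, +oo[, continuous f} ->
  (\int[mu]_(x in `[(c / n.+1%:R)%R, (c * n.+1%:R)%R]) (f x)%:E)%E @[n --> \oo]
   --> (\int[mu]_(x in `]0%R, +oo[) (f x)%:E)%E.
Proof.
move=> c0 f0 cf; rewrite -(bigcup_segment_0y c0).
have sub n : `[c / n.+1%:R, c * n.+1%:R]%classic `<=` (`]0, +oo[%classic : set R).
  move=> x /=; rewrite !in_itv/= andbT => /andP[+ _]; apply: lt_le_trans.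
  by rewrite divr_gt0.
apply: ge0_nondecreasing_set_cvg_integral.
- apply/nondecreasing_seqP => n; apply/subsetPset => x /=.
  rewrite !in_itv/= => /andP[h1 h2]; apply/andP; split.
    apply: le_trans h1; rewrite ler_pM2l// lef_pV2 ?posrE//.
    by rewrite ler_nat.
  by apply: (le_trans h2); rewrite ler_pM2l// ler_nat.
- by move=> n.
- move=> n; apply/measurable_EFinP.
  apply: (measurable_funS _ (sub n)) => //.
  apply: open_continuous_measurable_fun => //.
  by move=> x /set_mem; exact: cf.
- move=> n x /sub /=; rewrite in_itv/= andbT => x0; rewrite lee_fin; exact: f0.
Qed.

(** Either integral may be infinite, so the fundamental theorem of calculus is used
    on the segments [[1/n, n]] and each side then converges monotonically. *)
Lemma ge0_FTC_0y (f g F : R -> R) (a b : R) :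
  (forall x : R, 0 < x -> 0 <= f x) -> (forall x : R, 0 < x -> 0 <= g x) ->
  {in `]0, +oo[, continuous f} -> {in `]0, +oo[, continuous g} ->
  (forall x : R, 0 < x -> is_derive x 1 F (f x - g x)) ->
  F x @[x --> 0^'+] --> a -> F x @[x --> +oo] --> b ->
  (\int[mu]_(x in `]0%R, +oo[) (f x)%:E + a%:E =
   \int[mu]_(x in `]0%R, +oo[) (g x)%:E + b%:E)%E.
Proof.
move=> f0 g0 cf cg dF Fa Fb.
pose u n : R := 1 / n.+1%:R; pose v n : R := 1 * n.+1%:R.
have u0 n : 0 < u n by rewrite /u divr_gt0.
have cin (h : R -> R) n : {in `]0, +oo[, continuous h} -> {within `[u n, v n], continuous h}.
  move=> ch; apply: continuous_in_subspaceT => x /set_mem/=.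
  rewrite in_itv/= => /andP[ux _]; apply: ch.
  by rewrite in_itv/= andbT (lt_le_trans _ ux).
have uv n : u n.+1 < v n.+1.
  rewrite /u /v div1r mul1r.
  apply: (@lt_trans _ _ 1); last by rewrite ltr1n.
  by rewrite invf_lt1 ?ltr1n.
have ftc n : (\int[mu]_(x in `[u n.+1, v n.+1]) (f x - g x)%:E =
    (F (v n.+1))%:E - (F (u n.+1))%:E)%E.
  apply: continuous_FTC2 => //.
  - apply: (@cin (fun x => f x - g x)) => x x0; apply: continuousB; [exact: cf|exact: cg].
  - have dFx x : 0 < x -> {for x, continuous F}.
      move=> x0; apply: differentiable_continuous; apply/derivable1_diffP.
      by have [] := dF _ x0.
    split.
    + by move=> x; rewrite in_itv/= => /andP[ux _]; have [] := dF x (lt_trans (u0 _) ux).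
    + by apply: cvg_at_right_filter; apply: dFx.
    + by apply: cvg_at_left_filter; apply: dFx; apply: lt_trans (uv _).
  - move=> x; rewrite in_itv/= => /andP[ux _]; rewrite derive1E.
    by have [_ ->] := dF x (lt_trans (u0 _) ux).
have int (h : R -> R) n : {in `]0, +oo[, continuous h} -> mu.-integrable `[u n, v n] (EFin \o h).
  move=> ch; apply: continuous_compact_integrable; first exact: segment_compact.
  exact: cin.
have ftc' n : (\int[mu]_(x in `[u n.+1, v n.+1]) (f x)%:E + (F (u n.+1))%:E =
    \int[mu]_(x in `[u n.+1, v n.+1]) (g x)%:E + (F (v n.+1))%:E)%E.
  have := ftc n.
  under eq_integral do rewrite EFinB.
  rewrite integralB_EFin//; [|exact: int|exact: int].
  have fi (h : R -> R) : {in `]0, +oo[, continuous h} ->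
      (\int[mu]_(x in `[u n.+1, v n.+1]) (h x)%:E)%E \is a fin_num.
    by move=> ch; apply: integrable_fin_num => //; exact: int.
  rewrite -(fineK (fi f cf)) -(fineK (fi g cg)) -!EFinB -!EFinD.
  by move=> [] h; congr EFin; lra.
have cu : F (u n.+1) @[n --> \oo] --> a.
  move/cvg_at_rightP : Fa; apply; split => [n|]; first exact: u0.
  rewrite /u; under eq_fun do rewrite div1r.
  by have := @cvg_harmonic R; rewrite -(cvg_shiftS (@harmonic R)).
have cv : F (v n.+1) @[n --> \oo] --> b.
  apply: cvg_comp Fb; rewrite /v; under eq_fun do rewrite mul1r.
  have h : (n.+2%:R : R) @[n --> \oo] --> +oo.
    apply/cvgryPge => A; near=> n; apply: (@le_trans _ _ n%:R); last by rewrite ler_nat -addn2 leq_addr.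
    near: n; exact: nbhs_infty_ger.
  exact: h.
have cI (h : R -> R) : (forall x : R, 0 < x -> 0 <= h x) -> {in `]0, +oo[, continuous h} ->
    (\int[mu]_(x in `[u n.+1, v n.+1]) (h x)%:E)%E @[n --> \oo]
    --> (\int[mu]_(x in `]0%R, +oo[) (h x)%:E)%E.
  move=> h0 ch; have := cvg_integral_segment_0y (@ltr01 R) h0 ch.
  by rewrite -(cvg_shiftS (fun n => \int[mu]_(x in `[u n, v n]) (h x)%:E)%E).
have L : (\int[mu]_(x in `[u n.+1, v n.+1]) (f x)%:E + (F (u n.+1))%:E)%E @[n --> \oo]
   --> (\int[mu]_(x in `]0%R, +oo[) (f x)%:E + a%:E)%E.
  by apply: cvgeD; [rewrite fin_num_adde_defl|exact: cI|by apply: cvg_EFin => //; exact: nearW].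
have M : (\int[mu]_(x in `[u n.+1, v n.+1]) (g x)%:E + (F (v n.+1))%:E)%E @[n --> \oo]
   --> (\int[mu]_(x in `]0%R, +oo[) (g x)%:E + b%:E)%E.
  by apply: cvgeD; [rewrite fin_num_adde_defl|exact: cI|by apply: cvg_EFin => //; exact: nearW].
rewrite -(cvg_lim (@ereal_hausdorff R) L) -(cvg_lim (@ereal_hausdorff R) M).
by rewrite (funext ftc').
Unshelve. all: by end_near. Qed.

Lemma ge0_FTC_0y_eq (f g F : R -> R) :
  (forall x : R, 0 < x -> 0 <= f x) -> (forall x : R, 0 < x -> 0 <= g x) ->
  {in `]0, +oo[, continuous f} -> {in `]0, +oo[, continuous g} ->
  (forall x : R, 0 < x -> is_derive x 1 F (f x - g x)) ->
  F x @[x --> 0^'+] --> 0 -> F x @[x --> +oo] --> 0 ->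
  (\int[mu]_(x in `]0%R, +oo[) (f x)%:E = \int[mu]_(x in `]0%R, +oo[) (g x)%:E)%E.
Proof.
move=> f0 g0 cf cg dF F0 Fy; have := ge0_FTC_0y f0 g0 cf cg dF F0 Fy.
by rewrite (adde0 (\int[mu]_(x in _) (f x)%:E)%E) (adde0 (\int[mu]_(x in _) (g x)%:E)%E).
Qed.

Lemma is_derive_continuous (f : R -> R) (x df : R) :
  is_derive x 1 f df -> {for x, continuous f}.
Proof.
by move=> [dfx _]; apply: differentiable_continuous; exact/derivable1_diffP.
Qed.

(** The substitution is made on segments that avoid [0], where [G] may be singular. *)
Lemma integral_scale_0y (c : R) (G : R -> R) : 0 < c ->
  (forall x : R, 0 < x -> 0 <= G x) -> {in `]0, +oo[, continuous G} ->
  (\int[mu]_(x in `]0%R, +oo[) (G x)%:E =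
   \int[mu]_(x in `]0%R, +oo[) (G (c * x) * c)%:E)%E.
Proof.
move=> c0 G0 cG.
have L := cvg_integral_segment_0y c0 G0 cG.
have dF (x : R) : is_derive x 1 (fun y => c * y) c.
  by have := is_deriveZ c (is_derive_id x (1 : R)); rewrite /GRing.scale/= mulr1.
have dFE : (fun y => c * y)^`()%classic = cst c.
  by apply/funext => x; rewrite derive1E; have [_ ->] := dF x.
have M := @cvg_integral_segment_0y 1 (fun x => G (c * x) * c) ltr01.
rewrite -(cvg_lim (@ereal_hausdorff R) L) -(cvg_lim (@ereal_hausdorff R) (M _ _)); last 2 first.
- by move=> x x0; apply: mulr_ge0; [apply: G0; exact: mulr_gt0|exact: ltW].
- move=> x; rewrite in_itv/= andbT => x0; apply: cvgM; last exact: cvg_cst.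
  apply: (@continuous_comp _ _ _ (fun y => c * y) G); first exact: is_derive_continuous (dF x).
  by apply: cG; rewrite in_itv/= andbT mulr_gt0.
apply: (congr1 (fun w : nat -> \bar R => lim (w @ \oo))); apply/funext => n.
have := @integration_by_substitution_increasing R (fun x => c * x) G (1 / n.+1%:R) (1 * n.+1%:R).
rewrite /= !div1r !mul1r dFE => -> //.
- apply: (@le_trans _ _ 1); first by rewrite invf_le1 ?ler1n.
  by rewrite ler1n.
- by move=> x y _ _ xy; rewrite ltr_pM2l.
- by move=> x _; exact: cvg_cst.
- exact: is_cvg_cst.
- exact: is_cvg_cst.
- split.
  + by move=> x _; have [] := dF x.
  + by apply: cvg_at_right_filter; exact: is_derive_continuous (dF _).
  + by apply: cvg_at_left_filter; exact: is_derive_continuous (dF _).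
- apply: continuous_in_subspaceT => x /set_mem/=.
  rewrite in_itv/= => /andP[ux _]; apply: cG.
  by rewrite in_itv/= andbT (lt_le_trans _ ux)// divr_gt0.
Qed.

End HalfLine.

(** * The Gamma function *)

Section GammaFunction.
Context {R : realType}.
Notation mu := (@lebesgue_measure R).
Implicit Types (a c s x : R).

Definition gamma_density a s : R := s `^ (a - 1) * expR (- s).

Lemma is_derive_expRNM c s :
  is_derive s 1 (fun t => expR (- (c * t))) (- c * expR (- (c * s))).
Proof.
have h : is_derive s 1 (fun t => - (c * t)) (- c).
  have := is_deriveN (is_deriveZ c (is_derive_id s (1 : R))).
  by rewrite /GRing.scale/= mulr1.
by rewrite mulrC; exact: (@is_derive1_comp _ expR).
Qed.

Lemma is_derive_powRexp a c s : 0 < s ->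
  is_derive s 1 (fun t => t `^ a * expR (- (c * t)))
    (a * (s `^ (a - 1) * expR (- (c * s))) - c * (s `^ a * expR (- (c * s)))).
Proof.
move=> s0; have h := is_deriveM (is_derive1_powR a s0) (is_derive_expRNM c s).
apply: (is_derive_eq h); rewrite /GRing.scale/=; ring.
Qed.

Lemma continuous_powRexp a c :
  {in `]0, +oo[, continuous (fun s => s `^ a * expR (- (c * s)))}.
Proof.
move=> s; rewrite in_itv/= andbT => s0.
exact: is_derive_continuous (is_derive_powRexp a c s0).
Qed.

Lemma continuous_gamma_density a :
  {in `]0, +oo[, continuous (gamma_density a)}.
Proof.
have -> : gamma_density a = fun s => s `^ (a - 1) * expR (- (1 * s)).
  by apply/funext => s; rewrite mul1r.
exact: continuous_powRexp.
Qed.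

Lemma gamma_density_ge0 a s : 0 <= gamma_density a s.
Proof. by rewrite mulr_ge0 ?powR_ge0 ?expR_ge0. Qed.

Lemma cvg_expRNM_pinfty c : 0 < c -> expR (- (c * s)) @[s --> +oo] --> (0 : R).
Proof.
move=> c0; apply: (cvg_comp (fun s => c * s) (fun s => expR (- s))).
  by apply: gt0_cvgMry => //; exact: cvg_id.
exact: cvgr_expR.
Qed.

(** As [ln s < s / (2 a) + ln (2 a)], half of the exponential absorbs the power. *)
Lemma powRexp_le a s : 0 < a -> 0 < s ->
  s `^ a * expR (- s) <= (2 * a) `^ a * expR (- (2^-1 * s)).
Proof.
move=> a0 s0; have a20 : 0 < 2 * a by rewrite mulr_gt0.
rewrite /powR !gt_eqF// -!expRD ler_expR.
have h := ltW (ln_sublinear (divr_gt0 s0 a20)).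
rewrite ln_div ?posrE// in h.
have {}h : a * (ln s - ln (2 * a)) <= a * (s / (2 * a)) by rewrite ler_pM2l.
have e : a * (s / (2 * a)) = 2^-1 * s by field; rewrite gt_eqF.
by rewrite e in h; lra.
Qed.

Lemma cvg_powRexp_pinfty a : 0 < a -> s `^ a * expR (- s) @[s --> +oo] --> (0 : R).
Proof.
move=> a0.
apply: (@squeeze_cvgr _ _ _ _ (cst 0) (fun s => (2 * a) `^ a * expR (- (2^-1 * s)))).
- near=> s; have s0 : 0 < s by near: s; exact: nbhs_pinfty_gt.
  by rewrite mulr_ge0 ?powR_ge0 ?expR_ge0//=; exact: powRexp_le.
- exact: cvg_cst.
- rewrite -[X in _ --> X](mulr0 ((2 * a) `^ a)); apply: cvgMl_tmp.
  exact: cvg_expRNM_pinfty.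
Unshelve. all: by end_near. Qed.

Lemma cvg_powRexp_0 a : 0 < a -> s `^ a * expR (- s) @[s --> 0^'+] --> (0 : R).
Proof.
move=> a0; rewrite -[X in _ --> X](mul0r (expR (- 0) : R)).
apply: cvgM; first exact: powR_cvg0.
apply: cvg_at_right_filter; apply: (@continuous_comp _ _ _ -%R expR).
  exact: opp_continuous.
exact: continuous_expR.
Qed.

Lemma measurable_powRexp a c :
  measurable_fun (`]0, +oo[%classic : set R) (fun s => s `^ a * expR (- (c * s)) : R).
Proof.
apply: open_continuous_measurable_fun; first exact: interval_open.
by move=> x /set_mem; exact: continuous_powRexp.
Qed.

Lemma integral_expRNM_pinfty c : 0 < c ->
  (\int[mu]_(s in `]0%R, +oo[) (expR (- (c * s)))%:E = (c^-1)%:E)%E.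
Proof.
move=> c0.
have := @ge0_FTC_0y R (fun s => expR (- (c * s))) (cst 0)
  (fun s => - c^-1 * expR (- (c * s))) (- c^-1) 0.
move=> h; have {}h : (\int[mu]_(s in `]0%R, +oo[) (expR (- (c * s)))%:E + (- c^-1)%:E =
    \int[mu]_(s in `]0%R, +oo[) (cst 0 s)%:E + 0%:E)%E.
  apply: h => //.
  - by move=> s _; exact: is_derive_continuous (is_derive_expRNM c s).
  - by move=> s _; exact: cvg_cst.
  - move=> s _; have := is_deriveZ (- c^-1) (is_derive_expRNM c s).
    rewrite /GRing.scale/= subr0 => h; apply: (is_derive_eq h).
    by field; rewrite gt_eqF.
  - rewrite -[X in _ --> X]mulr1; apply: cvgMl_tmp.
    have e : expR (- (c * 0)) = 1 :> R by rewrite mulr0 oppr0 expR0.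
    rewrite -[X in _ --> X]e; apply: cvg_at_right_filter.
    exact: is_derive_continuous (is_derive_expRNM c 0).
  - by rewrite -(mulr0 (- c^-1)); apply: cvgMl_tmp; exact: cvg_expRNM_pinfty.
have z : (\int[mu]_(s in `]0%R, +oo[) (cst (0 : R) s)%:E = 0%:E)%E by exact: integral0_eq.
rewrite z -EFinD in h.
have e : (\int[mu]_(s in `]0%R, +oo[) (expR (- (c * s)))%:E)%E \is a fin_num.
  by move: h; case: (\int[mu]_(s in _) _)%E.
by move: h; rewrite -(fineK e) -EFinD => -[h]; congr EFin; lra.
Qed.

(** Extended-real valued, because its finiteness comes after the functional equation. *)
Definition gamma_integral a : \bar R :=
  (\int[mu]_(s in `]0%R, +oo[) (gamma_density a s)%:E)%E.

Lemma euler_integralE a : euler_integral a = fine (gamma_integral a).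
Proof. by []. Qed.

(** Integration by parts: [- s^a e^(-s)] vanishes at both ends. *)
Lemma gamma_integralS a : 0 < a ->
  gamma_integral (a + 1) = (a%:E * gamma_integral a)%E.
Proof.
move=> a0.
transitivity (\int[mu]_(s in `]0%R, +oo[) (a * gamma_density a s)%:E)%E; last first.
  under eq_integral do rewrite EFinM.
  rewrite ge0_integralZl_EFin ?ltW//.
  - by move=> s _; rewrite lee_fin gamma_density_ge0.
  - apply/measurable_EFinP; apply: open_continuous_measurable_fun => //.
    by move=> x /set_mem; exact: continuous_gamma_density.
apply: (@ge0_FTC_0y_eq R (gamma_density (a + 1)) _ (fun s => - (s `^ a * expR (- s)))).
- by move=> s _; exact: gamma_density_ge0.
- by move=> s _; rewrite mulr_ge0 ?gamma_density_ge0// ltW.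
- exact: continuous_gamma_density.
- by move=> s s0; apply: cvgMl_tmp; exact: continuous_gamma_density.
- move=> s s0; have := is_deriveN (is_derive_powRexp a 1 s0).
  have -> : - (fun t => t `^ a * expR (- (1 * t))) =
      (fun t => - (t `^ a * expR (- t))) :> (R -> R).
    by apply/funext => t; rewrite opprfctE mul1r.
  move=> h; apply: (is_derive_eq h).
  by rewrite /gamma_density addrK !mul1r; ring.
- by rewrite -[X in _ --> X]oppr0; apply: cvgN; exact: cvg_powRexp_0.
- by rewrite -[X in _ --> X]oppr0; apply: cvgN; exact: cvg_powRexp_pinfty.
Qed.

(** By [gamma_integralS] it is enough to bound the integral at [a + 1], whose
    integrand has no singularity at [0]. *)
Lemma gamma_integral_lty a : 0 < a -> (gamma_integral a < +oo)%E.
Proof.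
move=> a0; suff h : (gamma_integral (a + 1) < +oo)%E.
  move: h; rewrite gamma_integralS//; case: (gamma_integral a) => [r| |] //=.
    by move=> _; rewrite ltry.
  by rewrite gt0_muley ?lte_fin.
have mE c : measurable_fun (`]0, +oo[%classic : set R) (fun s => expR (- (c * s))).
  apply: open_continuous_measurable_fun => //.
  by move=> s _; exact: is_derive_continuous (is_derive_expRNM c s).
apply: (@le_lt_trans _ _
  (\int[mu]_(s in `]0%R, +oo[) ((2 * a) `^ a * expR (- (2^-1 * s)))%:E)%E).
  apply: ge0_le_integral => //.
  - by move=> s _; rewrite lee_fin gamma_density_ge0.
  - apply/measurable_EFinP.
    apply: open_continuous_measurable_fun => //.
    by move=> x /set_mem; exact: continuous_gamma_density.
  - by apply/measurable_EFinP; apply: measurable_funM => //; exact: mE.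
  - move=> s /=; rewrite in_itv/= andbT => s0; rewrite lee_fin /gamma_density addrK.
    exact: powRexp_le.
under eq_integral do rewrite EFinM.
rewrite ge0_integralZl_EFin ?powR_ge0//.
  by rewrite integral_expRNM_pinfty// -EFinM ltry.
by apply/measurable_EFinP; exact: mE.
Qed.

Lemma gamma_integral_fin_num a : 0 < a -> gamma_integral a \is a fin_num.
Proof.
move=> a0; rewrite ge0_fin_numE ?gamma_integral_lty//.
by apply: integral_ge0 => s _; rewrite lee_fin gamma_density_ge0.
Qed.

Lemma euler_integralS a : 0 < a -> euler_integral (a + 1) = a * euler_integral a.
Proof.
move=> a0; rewrite !euler_integralE gamma_integralS// fineM//.
exact: gamma_integral_fin_num.
Qed.

Lemma euler_integral_gt0 a : 0 < a -> 0 < euler_integral a.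
Proof.
move=> a0; rewrite euler_integralE fine_gt0// gamma_integral_lty// andbT.
(* on ]1, 2] the integrand is at least exp (- 2) / 2 *)
apply: (@lt_le_trans _ _ (\int[mu]_(s in `]1%R, 2%R]) (cst (2^-1 * expR (- 2))%:E s))%E).
  rewrite integral_cst//= lebesgue_measure_itv/= lte_fin ltr1n -EFinB -EFinM lte_fin.
  by rewrite mulr_gt0 ?subr_gt0 ?ltr1n// mulr_gt0 ?invr_gt0 ?expR_gt0.
apply: (@le_trans _ _ (\int[mu]_(s in `]1%R, 2%R]) (gamma_density a s)%:E)%E).
  have sub : `]1, 2]%classic `<=` (`]0, +oo[%classic : set R).
    by move=> x /=; rewrite !in_itv/= andbT => /andP[+ _]; apply: lt_trans.
  apply: ge0_le_integral => //.
  - by move=> s _; rewrite lee_fin mulr_ge0 ?expR_ge0.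
  - apply/measurable_EFinP; apply: (measurable_funS _ sub) => //.
    apply: open_continuous_measurable_fun => //.
    by move=> x /set_mem; exact: continuous_gamma_density.
  - move=> s /=; rewrite in_itv/= => /andP[s1 s2]; rewrite lee_fin.
    have s0 : 0 < s by exact: lt_trans s1.
    apply: ler_pM; rewrite ?expR_ge0//; last by rewrite ler_expR lerN2.
    rewrite powRB; last by apply/implyP => _; rewrite gt_eqF.
    rewrite (powRr1 (ltW s0)) ler_pdivlMr// mulrC.
    apply: (@le_trans _ _ (s `^ 0)); last by apply: ler_powR; exact: ltW.
    by rewrite powRr0 ler_pdivrMr// mul1r.
apply: ge0_subset_integral => //.
- apply/measurable_EFinP; apply: open_continuous_measurable_fun => //.
  by move=> x /set_mem; exact: continuous_gamma_density.
- by move=> s _; rewrite lee_fin gamma_density_ge0.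
- by move=> x /=; rewrite !in_itv/= andbT => /andP[+ _]; apply: lt_trans.
Qed.

Lemma Gamma_gt0 a : 0 < a -> Gamma a = euler_integral a.
Proof. by move=> a0; rewrite /Gamma a0. Qed.

(** As [l - 1 < |a - l| < l], the functional equation is unfolded exactly [l] times. *)
Lemma Gamma_subn a (l : nat) : 0 < a < 1 ->
  Gamma (a - l%:R) = euler_integral a / \prod_(i < l) (a - l%:R + i%:R).
Proof.
move=> /andP[a0 a1]; case: l => [|l].
  by rewrite subr0 big_ord0 divr1 Gamma_gt0.
have neg : a - l.+1%:R < 0.
  by rewrite subr_lt0 (lt_le_trans a1)// ler1n.
rewrite /Gamma ltNge (ltW neg)/=.
have -> : Num.truncn `|a - l.+1%:R| = l.
  apply/eqP; rewrite truncn_eq ?normr_ge0// ltr0_norm// opprB.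
  by rewrite -[l.+1%:R]natr1; apply/andP; split; lra.
by rewrite subrK.
Qed.

Lemma Gamma_subnS a (l : nat) : 0 < a < 1 ->
  Gamma (a - l%:R) = (a - l.+1%:R) * Gamma (a - l.+1%:R).
Proof.
move=> a01; have /andP[a0 a1] := a01.
rewrite !Gamma_subn// big_ord_recl /= addr0.
have e : \prod_(i < l) (a - l.+1%:R + (bump 0 i)%:R) = \prod_(i < l) (a - l%:R + i%:R).
  apply: eq_bigr => i _; rewrite /bump/= add1n -[l.+1%:R]natr1 -[i.+1%:R]natr1; ring.
have nz : a - l.+1%:R != 0 by rewrite lt_eqF// subr_lt0 (lt_le_trans a1)// ler1n.
by rewrite e invfM mulrCA [X in _ = _ * X]mulrA mulfV// mul1r.
Qed.

(** * Integrals against the Levy measure *)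

Lemma integral_powRexp_scale a c : 0 < a -> 0 < c ->
  (\int[mu]_(s in `]0%R, +oo[) (s `^ (a - 1) * expR (- (c * s)))%:E =
   (c `^ (- a) * euler_integral a)%:E)%E.
Proof.
move=> a0 c0.
have mf : measurable_fun (`]0, +oo[%classic : set R)
    (fun s => (s `^ (a - 1) * expR (- (c * s)))%:E).
  by apply/measurable_EFinP; exact: measurable_powRexp.
have := integral_scale_0y c0 (fun s _ => gamma_density_ge0 a s) (@continuous_gamma_density a).
rewrite -/(gamma_integral a) -(fineK (gamma_integral_fin_num a0)) -euler_integralE.
have -> : (\int[mu]_(s in `]0%R, +oo[) (gamma_density a (c * s) * c)%:E =
   (c `^ a)%:E * \int[mu]_(s in `]0%R, +oo[) (s `^ (a - 1) * expR (- (c * s)))%:E)%E.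
  rewrite -ge0_integralZl_EFin ?powR_ge0//; last first.
    by move=> s _; rewrite lee_fin mulr_ge0 ?powR_ge0 ?expR_ge0.
  apply: eq_integral => s; rewrite inE/= in_itv/= andbT => s0.
  rewrite -EFinM; congr EFin; rewrite /gamma_density powRM ?(ltW c0) ?(ltW s0)//.
  have -> : c `^ a = c `^ (a - 1) * c.
    by rewrite mulrC mulr_powRB1 // ltW.
  by ring.
move=> h; rewrite EFinM h muleA -EFinM powRN mulVf ?mul1e//.
by rewrite gt_eqF// powR_gt0.
Qed.

Context (alpha lambda : R).
Context (alpha01 : 0 < alpha < 1).
Context (lambda0 : 0 < lambda).

Let a0 : 0 < alpha. Proof. by case/andP: alpha01. Qed.
Let a1 : 0 < 1 - alpha. Proof. by rewrite subr_gt0; case/andP: alpha01. Qed.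

Lemma levy_integral_jump (l : nat) : (0 < l)%N ->
  levy_integral alpha (fun s => expR (- (lambda * s)) * s ^+ l) =
  lambda `^ (alpha - l%:R) * alpha * euler_integral (l%:R - alpha) / euler_integral (1 - alpha).
Proof.
move=> l0; have l1 : 1 <= l%:R :> R by rewrite ler1n.
have la : 0 < l%:R - alpha.
  by rewrite subr_gt0 (lt_le_trans _ l1)//; case/andP: alpha01.
have k0 : 0 < alpha / euler_integral (1 - alpha) by rewrite divr_gt0// euler_integral_gt0.
rewrite /levy_integral /Rintegral Gamma_gt0//.
have -> : (\int[mu]_(s in `]0%R, +oo[) (expR (- (lambda * s)) * s ^+ l *
    (alpha * s `^ (- alpha - 1) / euler_integral (1 - alpha)))%:E =
   (alpha / euler_integral (1 - alpha))%:E *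
   \int[mu]_(s in `]0%R, +oo[) (s `^ (l%:R - alpha - 1) * expR (- (lambda * s)))%:E)%E.
  rewrite -ge0_integralZl_EFin ?(ltW k0)//; last 2 first.
  - by move=> s _; rewrite lee_fin mulr_ge0 ?powR_ge0 ?expR_ge0.
  - by apply/measurable_EFinP; exact: measurable_powRexp.
  apply: eq_integral => s; rewrite inE/= in_itv/= andbT => s0.
  rewrite -EFinM; congr EFin.
  have -> : s `^ (l%:R - alpha - 1) = s ^+ l * s `^ (- alpha - 1).
    rewrite -powR_mulrn ?(ltW s0)// -powRD; last by rewrite (gt_eqF s0) implybT.
    by congr (_ `^ _); ring.
  ring.
rewrite integral_powRexp_scale// -EFinM /= opprB; ring.
Qed.

Lemma cvg_powRN_pinfty a : 0 < a -> s `^ (- a) @[s --> +oo] --> (0 : R).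
Proof.
move=> ha; apply/cvgrPdist_le => e e0; near=> s.
have s0 : 0 < s by near: s; exact: nbhs_pinfty_gt.
rewrite sub0r normrN ger0_norm ?powR_ge0// powRN invf_ple ?posrE ?powR_gt0//.
have h : (e^-1) `^ a^-1 <= s by near: s; apply: nbhs_pinfty_ge; exact: num_real.
have -> : e^-1 = (e^-1 `^ a^-1) `^ a.
  by rewrite -powRrM mulVf ?gt_eqF// powRr1// invr_ge0 ltW.
by apply: ge0_ler_powR; rewrite ?nnegrE ?powR_ge0 ?(ltW ha) ?(ltW s0).
Unshelve. all: by end_near. Qed.

(** The function [- (1 - e^(- lambda s)) s^(- alpha)] vanishes at both ends, and its
    derivative is the given integrand, up to its constant, minus
    [lambda s^(- alpha) e^(- lambda s)]. *)
Lemma levy_integral_total :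
  levy_integral alpha (fun s => 1 - expR (- (lambda * s))) = lambda `^ alpha.
Proof.
have k0 : 0 < (euler_integral (1 - alpha))^-1 by rewrite invr_gt0 euler_integral_gt0.
have e1 s : 0 < s -> expR (- (lambda * s)) <= 1.
  by move=> s0; rewrite expR_le1 oppr_le0 ltW// mulr_gt0.
pose f s : R := (1 - expR (- (lambda * s))) * (alpha * s `^ (- alpha - 1)).
pose g s : R := lambda * (s `^ (1 - alpha - 1) * expR (- (lambda * s))).
have df s : 0 < s -> is_derive s 1 (fun s => s `^ (- alpha) * expR (- (lambda * s)) - s `^ (- alpha))
    (f s - g s).
  move=> s0; have := is_deriveB (is_derive_powRexp (- alpha) lambda s0) (is_derive1_powR (- alpha) s0).
  move=> h; apply: (is_derive_eq h); rewrite /f /g.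
  have -> : 1 - alpha - 1 = - alpha by ring.
  ring.
have cf : {in `]0, +oo[, continuous f}.
  move=> s; rewrite in_itv/= andbT => s0; apply: cvgM.
    by apply: cvgB; [exact: cvg_cst|exact: is_derive_continuous (is_derive_expRNM _ _)].
  by apply: cvgMl_tmp; exact: is_derive_continuous (is_derive1_powR _ s0).
have cg : {in `]0, +oo[, continuous g}.
  by move=> s s0; apply: cvgMl_tmp; exact: continuous_powRexp.
have f0 s : 0 < s -> 0 <= f s.
  by move=> s0; rewrite mulr_ge0 ?subr_ge0 ?e1// mulr_ge0 ?powR_ge0// ltW.
have g0 s : 0 < s -> 0 <= g s.
  by move=> s0; rewrite mulr_ge0 ?(ltW lambda0)// mulr_ge0 ?powR_ge0 ?expR_ge0.
have F0 : s `^ (- alpha) * expR (- (lambda * s)) - s `^ (- alpha) @[s --> 0^'+] --> (0 : R).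
  apply/cvgr0Pnorm_le => e e0.
  apply: (@filterS _ _ _ (fun s => 0 < s /\ `|s `^ (1 - alpha)| <= e / lambda)).
    move=> s [s0 hs]; rewrite -[X in _ - X]mulr1 -mulrBr normrM ger0_norm ?powR_ge0//.
    rewrite distrC ger0_norm ?subr_ge0 ?e1//.
    have h1 : 1 - expR (- (lambda * s)) <= lambda * s.
      by have := expR_ge1Dx (- (lambda * s)); lra.
    apply: (@le_trans _ _ (s `^ (- alpha) * (lambda * s))).
      by rewrite ler_wpM2l ?powR_ge0.
    have -> : s `^ (- alpha) * (lambda * s) = lambda * s `^ (1 - alpha).
      by rewrite powRD ?(gt_eqF s0) ?implybT// powRr1 ?(ltW s0)//; ring.
    by rewrite mulrC -ler_pdivlMr// (le_trans (ler_norm _)).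
  apply: filterI; first exact: nbhs_right_gt.
  by have /cvgr0Pnorm_le := @powR_cvg0 R _ a1; apply; rewrite divr_gt0.
have Fy : s `^ (- alpha) * expR (- (lambda * s)) - s `^ (- alpha) @[s --> +oo] --> (0 : R).
  have e : 0 * 0 - 0 = 0 :> R by rewrite mulr0 subr0.
  rewrite -[X in _ --> X]e.
  apply: cvgB; last exact: cvg_powRN_pinfty.
  by apply: cvgM; [exact: cvg_powRN_pinfty|exact: cvg_expRNM_pinfty].
have fg := ge0_FTC_0y_eq f0 g0 cf cg df F0 Fy.
rewrite /levy_integral /Rintegral Gamma_gt0//.
have -> : (\int[mu]_(s in `]0%R, +oo[) ((1 - expR (- (lambda * s))) *
    (alpha * s `^ (- alpha - 1) / euler_integral (1 - alpha)))%:E =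
   (euler_integral (1 - alpha))^-1%:E * \int[mu]_(s in `]0%R, +oo[) (f s)%:E)%E.
  rewrite -ge0_integralZl_EFin ?(ltW k0)//; last 2 first.
  - by move=> s /=; rewrite in_itv/= andbT => s0; rewrite lee_fin f0.
  - apply/measurable_EFinP; apply: open_continuous_measurable_fun => //.
    by move=> s /set_mem; exact: cf.
  apply: eq_integral => s _; rewrite -EFinM; congr EFin; rewrite /f; ring.
rewrite fg.
have -> : (\int[mu]_(s in `]0%R, +oo[) (g s)%:E = lambda%:E *
    \int[mu]_(s in `]0%R, +oo[) (s `^ (1 - alpha - 1) * expR (- (lambda * s)))%:E)%E.
  rewrite -ge0_integralZl_EFin ?(ltW lambda0)//.
  - by move=> s _; rewrite lee_fin mulr_ge0 ?powR_ge0 ?expR_ge0.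
  - by apply/measurable_EFinP; exact: measurable_powRexp.
rewrite integral_powRexp_scale// -!EFinM /=.
have -> : - (1 - alpha) = alpha - 1 by ring.
rewrite -[RHS](mulr_powRB1 (ltW lambda0) a0).
by field; rewrite gt_eqF// euler_integral_gt0.
Qed.

End GammaFunction.

(** * Sibuya weights and jump rates *)

Section JumpRates.
Context {R : realType}.
Implicit Types (alpha lambda t u : R).

(** The weights [(-1)^(l+1) binom(alpha, l)] of the Sibuya distribution, the law of
    the height of a jump; [sum_l sibuya alpha l z^l = 1 - (1 - z)^alpha]. *)
Definition sibuya alpha (l : nat) : R :=
  if l is l'.+1 then alpha * \prod_(i < l') ((i.+1%:R - alpha) / i.+2%:R) else 0.

Lemma sibuya1 alpha : sibuya alpha 1 = alpha.
Proof. by rewrite /sibuya big_ord0 mulr1. Qed.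

Lemma sibuyaS alpha (l : nat) : (0 < l)%N ->
  l.+1%:R * sibuya alpha l.+1 = (l%:R - alpha) * sibuya alpha l.
Proof.
case: l => // l _; rewrite /sibuya big_ord_recr /=.
have n0 : l.+2%:R != 0 :> R by rewrite pnatr_eq0.
by move: l.+1%:R l.+2%:R n0 => x y y0; field.
Qed.

Lemma sibuya_ge0 alpha l : 0 < alpha < 1 -> 0 <= sibuya alpha l.
Proof.
move=> /andP[a0 a1]; case: l => // l; rewrite mulr_ge0 ?(ltW a0)// prodr_ge0// => i _.
by rewrite divr_ge0// subr_ge0 (le_trans (ltW a1))// ler1n.
Qed.

Definition jump_rate alpha lambda (l : nat) : R :=
  lambda ^+ l / l`!%:R *
  levy_integral alpha (fun s => expR (- (lambda * s)) * s ^+ l).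

(** By the functional equation of Gamma, both sides obey the recurrence of [sibuyaS]. *)
Lemma jump_rateE alpha lambda l : 0 < alpha < 1 -> 0 < lambda -> (0 < l)%N ->
  jump_rate alpha lambda l = lambda `^ alpha * sibuya alpha l.
Proof.
move=> alpha01 lambda0; have /andP[a0 a1] := alpha01.
have E1 : euler_integral (1 - alpha) != 0 by rewrite gt_eqF// euler_integral_gt0// subr_gt0.
have lam (m : nat) : lambda ^+ m * lambda `^ (alpha - m%:R) = lambda `^ alpha.
  rewrite -powR_mulrn ?(ltW lambda0)// -powRD ?(gt_eqF lambda0) ?implybT//.
  by congr (_ `^ _); ring.
have sib (m : nat) : m.+1`!%:R * sibuya alpha m.+1 * euler_integral (1 - alpha) =
    alpha * euler_integral (m.+1%:R - alpha).
  elim: m => [|m IH]; first by rewrite factS fact0 muln1 mul1r sibuya1.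
  have -> : m.+2%:R - alpha = m.+1%:R - alpha + 1 by rewrite -[m.+2%:R]natr1; ring.
  rewrite euler_integralS; last by rewrite subr_gt0 (lt_le_trans a1)// ler1n.
  rewrite [RHS]mulrCA -IH factS natrM.
  transitivity (m.+1`!%:R * (m.+2%:R * sibuya alpha m.+2) * euler_integral (1 - alpha)).
    by ring.
  by rewrite sibuyaS//; ring.
case: l => // l _; rewrite /jump_rate levy_integral_jump// -(lam l.+1).
have f0 : l.+1`!%:R != 0 :> R by rewrite pnatr_eq0 -lt0n fact_gt0.
have := sib l => h.
have -> : sibuya alpha l.+1 = alpha * euler_integral (l.+1%:R - alpha) /
    (l.+1`!%:R * euler_integral (1 - alpha)).
  by rewrite -h; field; rewrite f0 E1.
by field; rewrite f0 E1.
Qed.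

(** Both sides obey the recurrence of [sibuyaS], the right one because
    [Gamma (alpha + 1 - l) = (alpha - l) Gamma (alpha - l)]. *)
Lemma sibuya_Gamma alpha l : 0 < alpha < 1 -> (0 < l)%N ->
  sibuya alpha l = Gamma (alpha + 1) * (- 1) ^+ l.+1 *
    (l`!%:R * Gamma (alpha + 1 - l%:R))^-1.
Proof.
move=> alpha01; have /andP[a0 a1] := alpha01.
have E0 : euler_integral alpha != 0 by rewrite gt_eqF// euler_integral_gt0.
case: l => // l _.
have e (m : nat) : alpha + 1 - m.+1%:R = alpha - m%:R by rewrite -[m.+1%:R]natr1; ring.
have nz (m : nat) : alpha - m.+1%:R != 0.
  by rewrite lt_eqF// subr_lt0 (lt_le_trans a1)// ler1n.
have Gnz (m : nat) : Gamma (alpha - m%:R) != 0.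
  elim: m => [|m]; first by rewrite subr0 Gamma_gt0.
  by rewrite Gamma_subnS// mulf_eq0 negb_or => /andP[].
have fnz (m : nat) : m`!%:R != 0 :> R by rewrite pnatr_eq0 -lt0n fact_gt0.
rewrite e; elim: l => [|l IH].
  rewrite subr0 factS fact0 muln1 mul1r sibuya1 expr2 mulrNN !mulr1.
  by rewrite !Gamma_gt0 ?addr_gt0// euler_integralS// mulfK.
apply: (@mulfI _ l.+2%:R); first by rewrite pnatr_eq0.
rewrite sibuyaS// IH Gamma_subnS// (factS l.+1) natrM (exprS _ l.+2).
move: (nz l) (Gnz l.+1) (fnz l.+1) (pnatr_eq0 R l.+2).
move: (Gamma (alpha - l.+1%:R)) (l.+1`!%:R) ((- 1) ^+ l.+2) (l.+1%:R) (l.+2%:R) => G f s x y h1 h2 h3 /negbT h4.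
by field; rewrite h1 h2 h3 h4.
Qed.

End JumpRates.

Section SibuyaSeries.
Context {R : realType}.
Context (alpha : R) (K : nat).

Definition sibuya_poly : {poly R} := \poly_(i < K.+1) sibuya alpha i.
Local Notation B := sibuya_poly.

Lemma coef_deriv_onem (p : {poly R}) k :
  ((1 - 'X) * p^`())`_k = k.+1%:R * p`_k.+1 - k%:R * p`_k.
Proof.
rewrite mulrBl mul1r coefB coefXM; congr (_ - _).
  by rewrite coef_deriv mulr_natl.
by case: k => [|k]; rewrite ?mul0r//= coef_deriv mulr_natl.
Qed.

(** The series satisfies [(1 - z) B'(z) = alpha (1 - B(z))], and truncating it only
    alters the coefficients from [z^K] on. *)
Lemma deriv_sibuya_poly k : (k < K)%N ->
  ((1 - 'X) * B^`())`_k = (alpha *: (1 - B))`_k.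
Proof.
move=> kK; rewrite coef_deriv_onem coefZ coefB coef1 !coef_poly !ltnS kK (ltnW kK).
case: k kK => [|k] kK; first by rewrite sibuya1 mul0r mul1r subr0 /= !subr0 mulr1.
by rewrite sibuyaS//=; ring.
Qed.

(** These are the coefficients of
    [(1 - z) (B^(n+1))' = (n + 1) alpha (B^n - B^(n+1))]. *)
Lemma coef_sibuyaXn n k : (k < K)%N ->
  k.+1%:R * (B ^+ n.+1)`_k.+1 - k%:R * (B ^+ n.+1)`_k =
  n.+1%:R * alpha * ((B ^+ n)`_k - (B ^+ n.+1)`_k).
Proof.
move=> kK; rewrite -coef_deriv_onem deriv_exp /=.
have -> : (1 - 'X) * (B^`() * B ^+ n *+ n.+1) =
    n.+1%:R *: (((1 - 'X) * B^`()) * B ^+ n).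
  by rewrite -mul_polyC -mulr_natr polyC_natr; ring.
have e : ((1 - 'X) * B^`() * B ^+ n)`_k = (alpha *: (1 - B) * B ^+ n)`_k.
  rewrite !coefM; apply: eq_bigr => i _; rewrite deriv_sibuya_poly//.
  by rewrite (leq_ltn_trans _ kK)// -ltnS.
by rewrite coefZ e -scalerAl coefZ mulrBl mul1r coefB -exprS mulrA.
Qed.

Lemma sibuya_polyE : exists C : {poly R}, B = C * 'X.
Proof.
exists (\poly_(i < K) sibuya alpha i.+1); apply/polyP => k.
by rewrite coefMX !coef_poly; case: k.
Qed.

Lemma coef_sibuyaXn_small n k : (k < n)%N -> (B ^+ n)`_k = 0.
Proof. by move=> kn; have [C ->] := sibuya_polyE; rewrite exprMn coefMXn kn. Qed.

End SibuyaSeries.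

(** * State polynomials *)

Section StatePolynomial.
Context {R : realType}.
Context (alpha lambda : R).
Local Notation m := (lambda `^ alpha).

(** For [k <= K], the coefficient of [(t m)^n u^(n alpha - k)] in the [k]-th derivative
    of [exp (- t m u^alpha)] with respect to [u], after division by that exponential.
    Up to the factor [(-1)^k k! / n!] it is a coefficient of a power of the Sibuya
    series, which is how the state polynomials meet the jump rates. *)
Definition deriv_coef (K n k : nat) : R := (- 1) ^+ k * k`!%:R / n`!%:R * (sibuya_poly alpha K ^+ n)`_k.
Local Notation a := deriv_coef.

(** One more differentiation produces this recurrence, which is that of [coef_sibuyaXn]. *)
Lemma deriv_coefS K n k : (k < K)%N ->
  a K n.+1 k.+1 = (n.+1%:R * alpha - k%:R) * a K n.+1 k - alpha * a K n k.
Proof.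
move=> kK; have := coef_sibuyaXn alpha n kK.
rewrite /deriv_coef !factS !natrM (exprS _ k).
move: (sibuya_poly alpha K ^+ n.+1)`_k.+1 (sibuya_poly alpha K ^+ n.+1)`_k.
move: (sibuya_poly alpha K ^+ n)`_k => z x y h.
have n0 : n.+1%:R != 0 :> R by rewrite pnatr_eq0.
have f0 : n`!%:R != 0 :> R by rewrite pnatr_eq0 -lt0n fact_gt0.
have -> : -1 * (-1) ^+ k * (k.+1%:R * k`!%:R) / (n.+1%:R * n`!%:R) * x =
  - (-1) ^+ k * k`!%:R / (n.+1%:R * n`!%:R) * (k.+1%:R * x).
  by rewrite !mulrA; ring.
have -> : k.+1%:R * x = k%:R * y + n.+1%:R * alpha * (z - y) by rewrite -h; ring.
move: (n.+1%:R) (n`!%:R) n0 f0 => p q p0 q0.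
by field; rewrite p0 q0.
Qed.

Lemma deriv_coef0S K k : (k < K)%N -> a K 0 k.+1 = (0%:R * alpha - k%:R) * a K 0 k.
Proof.
move=> kK; rewrite /deriv_coef !expr0 !coef1 /= mulr0; case: k kK => [|k] kK /=.
  by rewrite mul0r subr0 mul0r.
by rewrite !mulr0.
Qed.

Lemma is_derive_powR_exp_powR (c w : R) k (u : R) : 0 < u ->
  is_derive u 1 (fun u => u `^ (w - k%:R) * expR (- (c * u `^ alpha)))
   ((w - k%:R) * u `^ (w - k.+1%:R) * expR (- (c * u `^ alpha)) -
    c * alpha * u `^ (w + alpha - k.+1%:R) * expR (- (c * u `^ alpha))).
Proof.
move=> u0.
have h1 : is_derive u 1 (fun u => - (c * u `^ alpha)) (- (c * (alpha * u `^ (alpha - 1)))).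
  by have := is_deriveN (is_deriveZ c (is_derive1_powR alpha u0)).
have h2 := @is_derive1_comp _ expR _ _ _ _ (is_derive_expR _) h1.
have h := is_deriveM (is_derive1_powR (w - k%:R) u0) h2.
apply: (is_derive_eq h); rewrite /GRing.scale/=.
have -> : w + alpha - k.+1%:R = (w - k%:R) + (alpha - 1) by rewrite -[k.+1%:R]natr1; ring.
have -> : w - k.+1%:R = w - k%:R - 1 by rewrite -[k.+1%:R]natr1; ring.
rewrite (@powRD _ u (w - k%:R) (alpha - 1)) ?(gt_eqF u0) ?implybT//.
ring.
Qed.

Lemma derive1n_exp_powR K t k (u : R) : (k <= K)%N -> 0 < u ->
  derive1n k (fun u : R => expR (- (t * m * u `^ alpha))) u =
  \sum_(n < K.+1) a K n k * (t * m) ^+ n *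
     (u `^ (n%:R * alpha - k%:R) * expR (- (t * m * u `^ alpha))).
Proof.
set c := t * m.
elim: k u => [|k IH] u kK u0.
  rewrite derive1n0 big_ord_recl /= big1 ?addr0 => [|i _].
    by rewrite /deriv_coef !expr0 coef1 /= mul0r subr0 powRr0 fact0 divr1 !mul1r.
  by rewrite /deriv_coef coef_sibuyaXn_small// mulr0 !mul0r.
rewrite derive1nS derive1E.
rewrite (@near_eq_derive _ _ _ _ (\sum_(n < K.+1) (a K n k * c ^+ n) \*:
    (fun u => u `^ (n%:R * alpha - k%:R) * expR (- (c * u `^ alpha))))) ?oner_eq0//; last first.
  near=> v; rewrite (IH _ (ltnW kK)); last by near: v; exact: lt_nbhsr.
  by rewrite fct_sumE; apply: eq_bigr.
have h := is_derive_sum (fun n : 'I_K.+1 => is_deriveZ (a K n k * c ^+ n)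
   (is_derive_powR_exp_powR c (n%:R * alpha) k u0)).
rewrite (derive_val (is_derive := h)) {h}.
under eq_bigr do rewrite /GRing.scale/= mulrBr.
rewrite big_split /= big_ord_recl /= [RHS]big_ord_recl /= -addrA; congr (_ + _).
  rewrite deriv_coef0S//; ring.
(* the last term of the shifted sum has no counterpart on the right *)
have aK : a K K k = 0 by rewrite /deriv_coef coef_sibuyaXn_small// mulr0.
rewrite [X in _ + X]big_ord_recr /= aK.
rewrite !(mulr0, mul0r) oppr0 addr0 -big_split /=; apply: eq_bigr => i _.
rewrite /bump /= add1n deriv_coefS//.
have -> : i%:R * alpha + alpha - k.+1%:R = i.+1%:R * alpha - k.+1%:R.
  by rewrite -[i.+1%:R]natr1; ring.
rewrite exprS; ring.
Unshelve. all: by end_near. Qed.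

Lemma state_polyE k t :
  state_poly alpha lambda k t =
  (\poly_(n < k.+1) (k`!%:R / n`!%:R * (sibuya_poly alpha k ^+ n)`_k * m ^+ n)).[t].
Proof.
rewrite /state_poly (@derive1n_exp_powR k)// horner_poly !mulr_sumr; apply: eq_bigr => n _.
rewrite !powR1 mul1r mulr1 /deriv_coef exprMn.
have -> : expR (m * t) = (expR (- (t * m)))^-1 by rewrite expRN invrK mulrC.
have e0 : expR (- (t * m)) != 0 by rewrite expR_eq0.
have n0 : n`!%:R != 0 :> R by rewrite pnatr_eq0 -lt0n fact_gt0.
have := @sqrr_sign R k; rewrite expr2.
move: ((-1) ^+ k) => s ss; rewrite -[RHS]mul1r -[X in _ = X * _]ss.
by field; rewrite n0 e0.
Qed.

Lemma derive1n_horner (p : {poly R}) n : derive1n n (horner p) = horner p^`(n).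
Proof.
elim: n => [|n IH]; first by rewrite derive1n0 derivn0.
by rewrite derive1nS IH derivnS; apply/funext => x; rewrite -derivE.
Qed.

Lemma state_coefE n k : (n <= k)%N -> state_coef alpha lambda n k =
  k`!%:R / n`!%:R * (sibuya_poly alpha k ^+ n)`_k * m ^+ n.
Proof.
move=> nk; rewrite /state_coef.
have -> : state_poly alpha lambda k = horner
  (\poly_(n < k.+1) (k`!%:R / n`!%:R * (sibuya_poly alpha k ^+ n)`_k * m ^+ n)).
  by apply/funext => t; exact: state_polyE.
rewrite derive1n_horner nderivn_def hornerMn -mulr_natr mulfK; last first.
  by rewrite pnatr_eq0 -lt0n fact_gt0.
by rewrite horner_coef0 coef_nderivn addn0 binn mulr1n coef_poly ltnS nk.
Qed.

(** The sum may start at [1] because the constant term vanishes for [k > 0]. *)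
Lemma state_sumE k t : (0 < k)%N ->
  \sum_(1 <= n < k.+1) state_coef alpha lambda n k * t ^+ n =
  k`!%:R * \sum_(n < k.+1) (m * t) ^+ n / n`!%:R * (sibuya_poly alpha k ^+ n)`_k.
Proof.
move=> k0; rewrite big_add1 /= big_mkord big_ord_recl /= expr0 coef1 gtn_eqF// mulr0 add0r.
rewrite mulr_sumr; apply: eq_bigr => n _.
rewrite /bump /= add1n state_coefE// exprMn.
ring.
Qed.

End StatePolynomial.

(** * Iterated integrals as a measure on tuples *)

Section IteratedIntegral.
Context {R : realType}.
Notation mu := (@lebesgue_measure R).
Local Notation tupR r := (r.-tuple (measurableTypeR R)).

Lemma iter_integral_ge0 r (F : tupR r -> \bar R) :
  (forall v, 0 <= F v)%E -> (0 <= iter_integral F)%E.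
Proof.
elim: r F => [|r IH] F F0 /=; first exact: F0.
by apply: integral_ge0 => x _; apply: IH => v; exact: F0.
Qed.

(** The parameter ranges over any measurable space, so that the induction can move
    the integration variables into it one at a time. *)
Lemma measurable_fun_iter_integral r d (T : measurableType d)
    (F : T * tupR r -> \bar R) :
  measurable_fun setT F -> (forall z, 0 <= F z)%E ->
  measurable_fun setT (fun x => iter_integral (fun v => F (x, v))).
Proof.
elim: r d T F => [|r IH] d T F mF F0 /=.
  apply: (measurableT_comp mF); apply: measurable_fun_pair => //.
pose F' (z : (T * measurableTypeR R) * tupR r) := F (z.1.1, cons_tuple z.1.2 z.2).
pose G (z : T * measurableTypeR R) := iter_integral (fun v : tupR r => F' (z, v)).
have mG : measurable_fun setT G.
  apply: IH => [|z]; last exact: F0.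
  apply: (measurableT_comp mF); apply: measurable_fun_pair => /=.
    exact: measurableT_comp.
  apply: (@measurable_cons _ _ (T * measurableTypeR R * tupR r)%type
    (measurableTypeR R) (fun z => z.1.2) r snd) => //.
  exact: (measurableT_comp measurable_snd measurable_fst).
apply: (@measurable_fun_fubini_tonelli_F _ _ T (measurableTypeR R) R mu G mG).
by move=> z; apply: iter_integral_ge0 => v; exact: F0.
Qed.

Lemma measurable_fun_iter_integral_cons r (F : tupR r.+1 -> \bar R) :
  measurable_fun setT F -> (forall v, 0 <= F v)%E ->
  measurable_fun [set: measurableTypeR R] (fun x => iter_integral (fun v : tupR r => F (cons_tuple x v))).
Proof.
move=> mF F0.
apply: (@measurable_fun_iter_integral r _ (measurableTypeR R)
   (fun z => F (cons_tuple z.1 z.2))) => // .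
apply: (measurableT_comp mF).
exact: (@measurable_cons _ _ (measurableTypeR R * tupR r)%type (measurableTypeR R) fst r snd).
Qed.

Lemma eq_iter_integral r (F G : tupR r -> \bar R) : F =1 G ->
  iter_integral F = iter_integral G.
Proof. by move=> /funext ->. Qed.

Lemma iter_integral_nneseries r (F : (tupR r -> \bar R)^nat) :
  (forall n, measurable_fun setT (F n)) -> (forall n v, 0 <= F n v)%E ->
  iter_integral (fun v => \sum_(n <oo) F n v)%E = (\sum_(n <oo) iter_integral (F n))%E.
Proof.
elim: r F => [//|r IH] F mF F0 /=.
under eq_integral => x _.
  rewrite IH; last 2 first.
  - by move=> n; apply: (measurableT_comp (mF n)); exact: (@measurable_cons _ _ (tupR r) (measurableTypeR R) (cst x) r id).
  - by move=> n v; exact: F0.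
  over.
rewrite integral_nneseries//.
- by move=> n; exact: measurable_fun_iter_integral_cons.
- by move=> n x _; apply: iter_integral_ge0 => v; exact: F0.
Qed.

Lemma iter_integralZl r (c : R) (F : tupR r -> \bar R) : 0 <= c ->
  measurable_fun setT F -> (forall v, 0 <= F v)%E ->
  iter_integral (fun v => c%:E * F v)%E = (c%:E * iter_integral F)%E.
Proof.
move=> c0; elim: r F => [//|r IH] F mF F0 /=.
under eq_integral => x _.
  rewrite IH; last 2 first.
  - by apply: (measurableT_comp mF); exact: (@measurable_cons _ _ (tupR r) (measurableTypeR R) (cst x) r id).
  - by move=> v; exact: F0.
  over.
rewrite ge0_integralZl_EFin//.
- by move=> x _; apply: iter_integral_ge0 => v; exact: F0.
- exact: measurable_fun_iter_integral_cons.
Qed.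

(** Lebesgue measure in dimension [r], in the form computed by iterated integration. *)
Definition tuple_volume r (A : set (tupR r)) : \bar R :=
  iter_integral (fun v => (\1_A v)%:E).

Let measurable_indicE r (A : set (tupR r)) : measurable A ->
  measurable_fun setT (fun v => (\1_A v : R)%:E).
Proof. by move=> mA; apply/measurable_EFinP; exact: measurable_indic. Qed.

Let tuple_volume0 r : tuple_volume (set0 : set (tupR r)) = 0%E.
Proof.
rewrite /tuple_volume; under eq_fun do rewrite indic0.
elim: r => [//|r IH] /=.
by under eq_integral do rewrite IH; rewrite integral0.
Qed.

Let tuple_volume_ge0 r (A : set (tupR r)) : (0 <= tuple_volume A)%E.
Proof. by apply: iter_integral_ge0 => v; rewrite lee_fin. Qed.

Let tuple_volume_sigma_additive r : semi_sigma_additive (@tuple_volume r).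
Proof.
move=> F mF tF mUF.
have -> : tuple_volume (\bigcup_n F n) = (\sum_(n <oo) tuple_volume (F n))%E.
  rewrite /tuple_volume -iter_integral_nneseries.
  - by apply: eq_iter_integral => v; rewrite indic_bigcup.
  - by move=> n; exact: measurable_indicE.
  - by move=> n v; rewrite lee_fin.
by apply: is_cvg_nneseries => n _ _; exact: tuple_volume_ge0.
Qed.

HB.instance Definition _ r := isMeasure.Build _ _ _ (@tuple_volume r)
  (@tuple_volume0 r) (@tuple_volume_ge0 r) (@tuple_volume_sigma_additive r).

Lemma measurable_tuple_box r (J : 'I_r -> set (measurableTypeR R)) : (forall j, measurable (J j)) ->
  measurable ([set v | forall j, J j (tnth v j)] : set (tupR r)).
Proof.
move=> mJ; have -> : [set v : tupR r | forall j, J j (tnth v j)] =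
    \bigcap_(j in setT) ((fun v : tupR r => tnth v j) @^-1` J j).
  by apply/seteqP; split=> v /= h j; [move=> _|]; exact: h.
apply: fin_bigcap_measurable => // j _.
by rewrite -[X in measurable X]setTI; apply: (measurable_tnth j) => //; exact: mJ.
Qed.

Lemma tuple_volume_box r (J : 'I_r -> set (measurableTypeR R)) :
  (forall j, measurable (J j)) -> (forall j, (mu (J j) < +oo)%E) ->
  tuple_volume [set v | forall j, J j (tnth v j)] = (\prod_(j < r) fine (mu (J j)))%:E.
Proof.
elim: r J => [|r IH] J mJ fJ.
  by rewrite big_ord0 /tuple_volume/= indicE mem_set// => -[].
rewrite big_ord_recl EFinM /tuple_volume /=.
have e x (v : tupR r) : (\1_([set v | forall j, J j (tnth v j)] : set (tupR r.+1)) (cons_tuple x v) : R)%:E =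
   ((\1_(J ord0) x)%:E * (\1_([set v | forall j, J (lift ord0 j) (tnth v j)] : set (tupR r)) v)%:E)%E.
  rewrite -EFinM !indicE -natrM mulnb; congr (nat_of_bool _)%:R%:E.
  apply/idP/andP => [/set_mem/= h|[/set_mem/= h0 /set_mem/= h]].
    split; apply/mem_set; first by have := h ord0; rewrite tnth0.
    by move=> j /=; have := h (lift ord0 j); rewrite tnthS.
  apply/mem_set => /= j; case: (unliftP ord0 j) => [i ->|->]; last by rewrite tnth0.
  by rewrite tnthS.
under eq_integral => x _.
  rewrite (eq_iter_integral (e x)) iter_integralZl//; last first.
    exact: (measurable_indicE (@measurable_tuple_box r (fun j => J (lift ord0 j)) (fun j => mJ _))).
  rewrite -/(tuple_volume _) (IH (fun j => J (lift ord0 j)))//.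
  over.
have fin : (mu (J ord0)) \is a fin_num by rewrite ge0_fin_numE.
rewrite ge0_integralZr//=.
- by rewrite integral_indic// setIT fineK.
- by apply/measurable_EFinP; exact: measurable_indic.
- by rewrite lee_fin prodr_ge0// => i _; rewrite fine_ge0.
Qed.

Lemma iter_integral_indic r (c : R) (A : set (tupR r)) : 0 <= c -> measurable A ->
  iter_integral (fun v : r.-tuple R => (\1_A v * c)%:E) = (c%:E * tuple_volume A)%E.
Proof.
move=> c0 mA; rewrite -iter_integralZl//; last exact: measurable_indicE.
by apply: eq_iter_integral => v; rewrite mulrC EFinM.
Qed.

(** The bounds are extended reals, so that the whole space is an orthant. *)
Definition orthant r (x : 'I_r -> \bar R) : set (tupR r) :=
  [set v | forall j, ((tnth v j)%:E <= x j)%E].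

Lemma measurable_orthant r (x : 'I_r -> \bar R) : measurable (orthant x).
Proof.
apply: (@measurable_tuple_box r (fun j => [set s | (s%:E <= x j)%E])) => j.
case: (x j) => [a| |].
- have -> : [set s : measurableTypeR R | (s%:E <= a%:E)%E] = `]-oo, a]%classic.
    by apply/seteqP; split=> s /=; rewrite in_itv/= lee_fin.
  exact: measurable_itv.
- have -> : [set s : measurableTypeR R | (s%:E <= +oo)%E] = setT.
    by apply/seteqP; split=> s //= _; rewrite leey.
  exact: measurableT.
- have -> : [set s : measurableTypeR R | (s%:E <= -oo)%E] = set0.
    by apply/seteqP; split=> s.
  exact: measurable0.
Qed.

Lemma measurable_tuple_orthant r :
  @measurable _ (tupR r) = <<s [set A | exists x, A = orthant x] >>.
Proof.
apply/seteqP; split=> [A mA|]; last first.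
  apply: smallest_sub; first exact: sigma_algebra_measurable.
  by move=> _ [x ->]; exact: measurable_orthant.
pose S := [set A : set (tupR r) | exists x, A = orthant x].
suff mid : measurable_fun [set: g_sigma_algebraType S] (id : g_sigma_algebraType S -> tupR r).
  by have := mid measurableT A mA; rewrite setTI.
apply/measurable_fun_tnthP => j.
apply: (@measurability _ _ (g_sigma_algebraType S) (measurableTypeR R) setT
  (fun v : tupR r => tnth v j) _ (RGenOInfty.measurableE R)) => _ [_ [a ->] <-].
rewrite setTI.
have -> : (fun v : tupR r => tnth v j) @^-1` `]a, +oo[%classic =
    ~` orthant (fun i => if i == j then a%:E else +oo%E).
  apply/seteqP; split=> v /=; rewrite in_itv/= andbT.
    by move=> av /(_ j); rewrite eqxx lee_fin leNgt av.
  move=> h; rewrite ltNge; apply/negP => va; apply: h => i.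
  by case: eqP => [->|_]; rewrite ?lee_fin// leey.
apply: (@measurableC _ (g_sigma_algebraType S)).
by apply: sub_gen_smallest; eexists.
Qed.

(** The pi-lambda theorem for the pi-system of orthants. *)
Lemma orthant_induction r (Q : set (tupR r) -> Prop) :
  (forall x, Q (orthant x)) ->
  (forall A, measurable A -> Q A -> Q (~` A)) ->
  (forall F : (set (tupR r))^nat, (forall n, measurable (F n)) ->
    trivIset setT F -> (forall n, Q (F n)) -> Q (\bigcup_n F n)) ->
  forall A, measurable A -> Q A.
Proof.
move=> Qo QC QU A; rewrite measurable_tuple_orthant.
apply: (@dynkin_induction _ (tupR r)) => //.
- exact: measurable_tuple_orthant.
- move=> _ _ [x ->] [y ->]; exists (fun j => Order.min (x j) (y j)).
  apply/seteqP; split=> v /=.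
    by move=> [h1 h2] j; rewrite le_min h1 h2.
  by move=> h; split=> j; have := h j; rewrite le_min => /andP[].
- have -> : [set: tupR r] = orthant (fun=> +oo%E) by apply/seteqP; split=> v // _ j; rewrite leey.
  exact: Qo.
- by move=> _ [x ->].
Qed.

End IteratedIntegral.

(** Dominated convergence for indicators. *)
Lemma cvg_measure_pointwise d (T : measurableType d) (R : realType)
    (m : {measure set T -> \bar R}) (D : set T) (A_ : (set T)^nat) (A : set T) :
  measurable D -> (m D < +oo)%E -> (forall n, measurable (A_ n)) -> measurable A ->
  (forall n, A_ n `<=` D) -> (forall x, \forall n \near \oo, A_ n x <-> A x) ->
  m (A_ n) @[n --> \oo] --> m A.
Proof.
move=> mD Dfin mA_ mA AD cA.
have AsubD : A `<=` D.
  by move=> x Ax; have [n _ h] := cA x; apply: (AD n); exact: (h n (leqnn n)).2.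
have mE (B : set T) : measurable B -> measurable_fun D (fun x => (\1_B x : R)%:E).
  by move=> mB; apply/measurable_EFinP; exact: measurable_indic.
have e (B : set T) : measurable B -> B `<=` D ->
    (\int[m]_(x in D) (\1_B x)%:E = m B)%E.
  by move=> mB BD; rewrite integral_indic// (setIidl BD).
have [] := @dominated_convergence _ T R m D mD (fun n x => (\1_(A_ n) x)%:E)
  (fun x => (\1_A x)%:E) (cst 1%E).
- by move=> n; exact: mE.
- exact: mE.
- apply: aeW => x Dx; apply: cvg_near_cst; near=> n; congr EFin; rewrite !indicE.
  congr (nat_of_bool _)%:R; apply/idP/idP => /set_mem h; apply/mem_set.
    by have [+ _] : A_ n x <-> A x; [near: n; exact: cA|exact].
  by have [_ +] : A_ n x <-> A x; [near: n; exact: cA|exact].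
- apply/integrableP; split => //.
  under eq_integral do rewrite gee0_abs//.
  by rewrite integral_cst// mul1e.
- by apply: aeW => x n Dx; rewrite gee0_abs ?lee_fin// indicE lern1 leq_b1.
move=> _ _; rewrite (e A)//; apply: cvg_trans; apply: near_eq_cvg; near=> n.
exact: e.
Unshelve. all: by end_near. Qed.

(** * Jumps of a counting path *)

Section CountingPath.
Context {R : realType}.
Implicit Types (f : R -> nat) (a b s t u : R).

Definition counting_path f : Prop :=
  (forall s t, 0 <= s -> s <= t -> (f s <= f t)%N) /\
  (forall t, 0 <= t -> ((f u)%:R : R) @[u --> t^'+] --> ((f t)%:R : R)).

Lemma jump_heightE f a s : a < s -> (forall u, a <= u < s -> f u = f a) ->
  jump_height f s = (f s)%:R - (f a)%:R.
Proof.
move=> as_ fa; rewrite /jump_height; congr (_ - _).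
apply: cvg_lim => //; apply: cvg_near_cst; near=> u.
by rewrite fa//; apply/andP; split; near: u; [exact: nbhs_left_ge|exact: nbhs_left_lt].
Unshelve. all: by end_near. Qed.

Section OnePath.
Context (f : R -> nat).
Context (pf : counting_path f).

Let mono s t : 0 <= s -> s <= t -> (f s <= f t)%N. Proof. exact: (proj1 pf). Qed.

Lemma path_right_constant t : 0 <= t ->
  exists2 e : R, 0 < e & forall u, t <= u < t + e -> f u = f t.
Proof.
move=> t0; have /cvgrPdist_lt/(_ _ (@ltr01 R)) := proj2 pf t t0.
move=> [e /= e0 he]; exists e => // u /andP[]; rewrite le_eqVlt => /predU1P[->//|tu] ue.
have := he u; rewrite /= ltr_distlC; move=> /(_ _ tu).
have -> : t - e < u < t + e by rewrite ue andbT (lt_trans _ tu)// ltrBlDr ltrDl.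
move=> /(_ isT); have := mono t0 (ltW tu); rewrite leq_eqVlt => /predU1P[->//|ftu].
by rewrite distrC ger0_norm ?subr_ge0 ?ler_nat ?(ltnW ftu)// -natrB ?(ltnW ftu)// -[X in _ < X]/(1%:R) ltr_nat ltnS leqn0 subn_eq0 leqNgt ftu.
Qed.

Lemma path_left_constant s : 0 < s ->
  exists2 u0, 0 <= u0 < s & forall u, u0 <= u < s -> f u = f u0.
Proof.
move=> s0; pose Q m := `[< exists2 u, 0 <= u < s & f u = m >].
have exQ : exists m, Q m by exists (f 0); apply/asboolP; exists 0 => //; rewrite lexx.
have bQ m : Q m -> (m <= f s)%N.
  by move=> /asboolP[u /andP[u0 us] <-]; exact: mono (ltW us).
have := @ex_maxnP Q (f s) exQ bQ; case=> m /asboolP[u0 /andP[u00 u0s] fu0] hm.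
exists u0; first by rewrite u00.
move=> u /andP[uu us]; apply/eqP; rewrite eqn_leq [X in _ && X]mono// andbT fu0.
by apply: hm; apply/asboolP; exists u => //; rewrite us (le_trans u00).
Qed.

(** The jump is at the infimum [c] of the times where [f] exceeds [f a]: by right
    continuity [f] exceeds [f a] at [c] itself, and it does not before. *)
Lemma path_first_jump a b : 0 <= a -> a <= b -> (f a < f b)%N ->
  exists c, [/\ a < c <= b, jump_height f c != 0, (f a < f c)%N &
    forall u, a <= u < c -> f u = f a].
Proof.
move=> a0 ab fab; pose S := [set s | a <= s <= b /\ (f a < f s)%N].
have Sb : S b by split => //; rewrite ab lexx.
have infS : has_inf S by split; [exists b|exists a => s [/andP[]]].
pose c := inf S.
have ac : a <= c by apply: lb_le_inf; [exists b|move=> s [/andP[]]].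
have cb : c <= b by apply: ge_inf => //; exists a => s [/andP[]].
have c0 : 0 <= c by exact: le_trans ac.
have fac : (f a < f c)%N.
  have [e e0 he] := path_right_constant c0.
  have [s [Hs fs] sc] := inf_adherent e0 infS.
  rewrite -(he s)// sc andbT; apply: ge_inf; last by split.
  by exists a => z [/andP[]].
have {}ac : a < c by rewrite lt_neqAle ac andbT; apply: contraTneq fac => ->; rewrite ltnn.
have fu u : a <= u < c -> f u = f a.
  move=> /andP[au uc]; apply/eqP; rewrite eqn_leq [X in _ && X]mono// andbT leqNgt; apply/negP => h.
  have : c <= u.
    apply: ge_inf; first by exists a => z [/andP[]].
    by split => //; rewrite au (le_trans (ltW uc) cb).
  by rewrite leNgt uc.
exists c; split => //; first by rewrite ac cb.
by rewrite (jump_heightE ac fu) subr_eq0 eqr_nat gtn_eqF.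
Qed.

Lemma path_no_jump a b : 0 <= a -> a <= b ->
  (forall s, a < s <= b -> jump_height f s = 0) -> f a = f b.
Proof.
move=> a0 ab nj; apply/eqP; rewrite eqn_leq mono//= leqNgt; apply/negP => h.
by have [c [Hc /eqP jc _ _]] := path_first_jump a0 ab h; exact/jc/nj.
Qed.

(** The path is constant on either side of its only jump in the interval. *)
Lemma path_single_jump a b s : 0 <= a -> a < s <= b ->
  (forall u, a < u <= b -> jump_height f u != 0 -> u = s) ->
  jump_height f s = (f b - f a)%N%:R.
Proof.
move=> a0 /andP[as_ sb] us.
have s0 : 0 < s by exact: le_lt_trans as_.
have [u0 /andP[u00 u0s] hu0] := path_left_constant s0.
have fb : f s = f b.
  apply: path_no_jump => //; first exact: ltW.
  move=> u /andP[su ub]; apply/eqP/negP => /negP ju.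
  have := us u; rewrite ub (lt_trans as_ su) => /(_ isT ju) e.
  by rewrite e ltxx in su.
pose v := Order.max a u0.
have vs : v < s by rewrite gt_max as_ u0s.
have v0 : 0 <= v by rewrite le_max a0.
have fv : f a = f v.
  apply: path_no_jump => //; first by rewrite le_max lexx.
  move=> u /andP[au uv]; apply/eqP/negP => /negP ju.
  have us' : u < s by exact: le_lt_trans vs.
  have := us u; rewrite au (le_trans (ltW us') sb) => /(_ isT ju) e.
  by rewrite e ltxx in us'.
rewrite (@jump_heightE _ v)//; last first.
  move=> u /andP[vu us']; rewrite !hu0 ?us' ?vs ?le_max ?lexx ?orbT//.
  by rewrite (le_trans _ vu)// le_max lexx orbT.
by rewrite -fv fb natrB// mono// (le_trans (ltW as_)).
Qed.

Lemma path_constant_no_jump a s : a < s -> (forall u, a <= u <= s -> f u = f a) ->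
  jump_height f s = 0.
Proof.
move=> as_ h; rewrite (@jump_heightE _ a)//; last first.
  by move=> u /andP[au us]; apply: h; rewrite au ltW.
by rewrite h ?subrr// lexx ltW.
Qed.

(** Induction on the remaining increase, of which each jump uses up at least one unit. *)
Lemma path_jumps_finite t : 0 <= t -> exists L : seq R,
  forall s, 0 < s <= t -> jump_height f s != 0 -> s \in L.
Proof.
move=> t0.
suff h n a : 0 <= a <= t -> (f t - f a <= n)%N -> exists L : seq R,
    forall s, a < s <= t -> jump_height f s != 0 -> s \in L.
  by apply: (h (f t - f 0)%N) => //; rewrite lexx.
elim: n a => [|n IH] a /andP[a0 at_] fn.
  exists [::] => s /andP[as_ st] /eqP[].
  have fta : f t = f a.
    by apply/eqP; rewrite eqn_leq [X in _ && X]mono// andbT -subn_eq0 -leqn0.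
  apply: (path_constant_no_jump as_) => u /andP[au us].
  apply/eqP; rewrite eqn_leq [X in _ && X]mono// andbT -fta.
  by rewrite mono ?(le_trans a0)// (le_trans us).
have [fat|fat] := ltnP (f a) (f t); last first.
  apply: IH; first by rewrite a0.
  by rewrite leq_subLR (leq_trans fat)// leq_addr.
have [c [/andP[ac ct] jc fac hc]] := path_first_jump a0 at_ fat.
have [||L HL] := IH c.
- by rewrite ct (le_trans a0 (ltW ac)).
- by rewrite -ltnS (leq_trans _ fn)// ltn_sub2l.
exists (c :: L) => s /andP[as_ st] js; rewrite inE.
have [->|cs] := eqVneq s c => //=.
have /orP[cs'|sc'] := lt_total cs; last by apply: HL => //; rewrite sc' st.
move: js; rewrite (@path_constant_no_jump a) ?eqxx// => u /andP[au us].
by apply: hc; rewrite au (le_lt_trans us).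
Qed.

End OnePath.
End CountingPath.

(** * Grids and cells *)

Section Grid.
Context {R : realType}.
Implicit Types (s t : R) (n : nat).

Definition grid t n (c : nat) : R := t * c%:R / n.+1%:R.

Lemma grid0 t n : grid t n 0 = 0.
Proof. by rewrite /grid mulr0 mul0r. Qed.

Lemma grid_last t n : grid t n n.+1 = t.
Proof. by rewrite /grid mulfK// pnatr_eq0. Qed.

Lemma gridS t n c : grid t n c.+1 = grid t n c + t / n.+1%:R.
Proof. by rewrite /grid -natr1 mulrDr mulr1 mulrDl. Qed.

Lemma grid_le t n c c' : 0 <= t -> (c <= c')%N -> grid t n c <= grid t n c'.
Proof. by move=> t0 cc; rewrite ler_wpM2r ?invr_ge0// ler_wpM2l// ler_nat. Qed.

Lemma grid_ge0 t n c : 0 <= t -> 0 <= grid t n c.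
Proof. by move=> t0; rewrite -(grid0 t n) grid_le. Qed.

Definition in_cell t n (c : nat) : set R := [set s | grid t n c < s <= grid t n c.+1].

Lemma in_cell_exists t n s : 0 < s <= t -> exists c : 'I_n.+1, in_cell t n c s.
Proof.
move=> /andP[s0 st]; have t0 : 0 <= t by exact: le_trans (ltW s0) st.
have ex : exists c, s <= grid t n c.+1 by exists n; rewrite grid_last.
have := ex_minnP ex; case=> c sc hc.
have cn : (c < n.+1)%N by rewrite ltnS; apply: hc; rewrite grid_last.
exists (Ordinal cn); rewrite /in_cell /= sc andbT ltNge; apply/negP => h.
case: c sc hc h {cn} => [|c] sc hc h; first by rewrite grid0 leNgt s0 in h.
by have := hc _ h; rewrite ltnn.
Qed.

Lemma in_cell_le t n c c' s s' : 0 <= t -> s <= s' ->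
  in_cell t n c s -> in_cell t n c' s' -> (c <= c')%N.
Proof.
move=> t0 ss /andP[cs _] /andP[_ sc']; rewrite leqNgt; apply/negP => h.
have := grid_le n t0 h; rewrite leNgt => /negP; apply.
by rewrite (lt_le_trans cs)// (le_trans ss).
Qed.

Lemma in_cell_inj t n c c' s : 0 <= t -> in_cell t n c s -> in_cell t n c' s -> c = c'.
Proof.
by move=> t0 h h'; apply/eqP; rewrite eqn_leq (in_cell_le t0 _ h h') ?(in_cell_le t0 _ h' h).
Qed.

Lemma in_cell_lt t n c c' s s' : 0 <= t -> (c < c')%N ->
  in_cell t n c s -> in_cell t n c' s' -> s < s'.
Proof.
move=> t0 cc /andP[_ sc] /andP[cs' _]; apply: le_lt_trans cs'.
by rewrite (le_trans sc)// grid_le.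
Qed.

Lemma in_cell_bound t n (c : 'I_n.+1) s : 0 <= t -> in_cell t n c s -> 0 < s <= t.
Proof.
move=> t0 /andP[cs sc]; rewrite (le_lt_trans _ cs) ?grid_ge0//=.
by rewrite (le_trans sc)// -[leRHS](grid_last t n) grid_le.
Qed.

Lemma in_cell_dist t n c s s' : in_cell t n c s -> in_cell t n c s' ->
  s' - s < t / n.+1%:R.
Proof.
rewrite /in_cell /= gridS; move: (grid t n c) (t / _) => g h.
by move=> /andP[cs _] /andP[_ sc']; lra.
Qed.

Lemma in_cell_near t n c s : in_cell t n c s -> s - grid t n c <= t / n.+1%:R.
Proof. by rewrite /in_cell /= gridS => /andP[_ sc]; rewrite lerBlDl. Qed.

Lemma near_mesh t (e : R) : 0 < e -> \forall n \near \oo, t / n.+1%:R < e.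
Proof.
move=> e0; near=> n; rewrite ltr_pdivrMr//.
have h : t / e <= n%:R by near: n; exact: nbhs_infty_ger.
rewrite mulrC -ltr_pdivrMr// (le_lt_trans h)// ltr_nat//.
Unshelve. all: by end_near. Qed.

Lemma positive_lower_bound (D : seq R) :
  exists2 e : R, 0 < e & forall d, d \in D -> 0 < d -> e <= d.
Proof.
elim: D => [|a D [e e0 he]]; first by exists 1.
have [a0|a0] := ltP 0 a.
  exists (Order.min a e); first by rewrite lt_min a0.
  move=> d; rewrite inE => /predU1P[->|dD] d0; first by rewrite ge_min lexx.
  by rewrite ge_min he ?orbT.
exists e => // d; rewrite inE => /predU1P[->|dD] d0; last exact: he.
by rewrite leNgt in a0; rewrite d0 in a0.
Qed.

(** Below this mesh, distinct points of [L] lie in distinct cells, and a point of [L]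
    whose cell starts below [x j] is itself at most [x j]. *)
Lemma mesh_bound (L : seq R) r (x : 'I_r -> \bar R) : exists2 e : R, 0 < e &
  (forall s s', s \in L -> s' \in L -> s < s' -> e <= s' - s) /\
  (forall s j g, s \in L -> (g%:E < x j)%E -> s - g < e -> (s%:E <= x j)%E).
Proof.
have [e e0 he] := positive_lower_bound
  ([seq s' - s | s' <- L, s <- L] ++ [seq s - fine (x j) | s <- L, j <- enum 'I_r]).
exists e => //; split=> [s s' sL s'L ss|s j g sL].
  apply: he; last by rewrite subr_gt0.
  by rewrite mem_cat; apply/orP; left; apply/allpairsP; exists (s', s).
have : s - fine (x j) \in [seq s - fine (x j) | s <- L, j <- enum 'I_r].
  by apply/allpairsP; exists (s, j); split => //=; rewrite mem_enum.
case: (x j) => [a| |] //= aL; last by rewrite leey.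
rewrite lte_fin lee_fin => ga sg; rewrite leNgt; apply/negP => as_.
have := he (s - a); rewrite mem_cat aL orbT subr_gt0 => /(_ isT as_); lra.
Qed.

Definition increasing_cells r n (i : {ffun 'I_r -> 'I_n.+1}) : Prop :=
  forall a b : 'I_r, (a < b)%N -> (i a < i b)%N.

Lemma increasing_cells_inj r n (i : {ffun 'I_r -> 'I_n.+1}) :
  increasing_cells i -> injective i.
Proof.
by move=> hi a b ab; case: (ltngtP a b) => [/hi|/hi|/val_inj//]; rewrite ab ltnn.
Qed.

(** The increments over the cells of a path that jumps by [l j] in the [i j]-th cell
    and is constant on the other cells. *)
Definition cell_values r (l : 'I_r -> nat) n (i : {ffun 'I_r -> 'I_n.+1}) (c : nat) : nat :=
  \sum_(j < r | i j == c :> nat) l j.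

Lemma cell_values_in r l n (i : {ffun 'I_r -> 'I_n.+1}) j :
  increasing_cells i -> cell_values l i (i j) = l j.
Proof.
move=> hi; rewrite /cell_values (big_pred1 j)// => k /=.
by apply/eqP/eqP => [/val_inj|->//]; exact: increasing_cells_inj.
Qed.

Lemma cell_values_out r l n (i : {ffun 'I_r -> 'I_n.+1}) c :
  (forall j, i j != c :> nat) -> cell_values l i c = 0%N.
Proof. by move=> h; rewrite /cell_values big_pred0// => k; exact/negbTE. Qed.

Lemma cell_values_neq0 r l n (i : {ffun 'I_r -> 'I_n.+1}) c :
  cell_values l i c != 0%N -> exists j, i j = c :> nat.
Proof.
apply: contraNP => /forallNP h; apply/eqP/cell_values_out => j.
by apply/eqP; exact: h.
Qed.

(** Both maps enumerate the same finite set in increasing order. *)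
Lemma increasing_eq d (T : porderType d) r (f g : 'I_r -> T) :
  (forall a b : 'I_r, (a < b)%N -> (f a < f b)%O) ->
  (forall a b : 'I_r, (a < b)%N -> (g a < g b)%O) ->
  (forall a, exists b, f a = g b) -> (forall a, exists b, g a = f b) -> f =1 g.
Proof.
move=> hf hg fg gf.
have srt (h : 'I_r -> T) : (forall a b : 'I_r, (a < b)%N -> (h a < h b)%O) ->
    sorted (fun x y => (x < y)%O) [seq h j | j <- enum 'I_r].
  move=> hh; rewrite sorted_map.
  have : sorted ltn [seq val j | j <- enum 'I_r] by rewrite val_enum_ord iota_ltn_sorted.
  by rewrite sorted_map; apply: sub_sorted => a b /=; exact: hh.
have e : [seq f j | j <- enum 'I_r] = [seq g j | j <- enum 'I_r].
  apply: (irr_sorted_eq (leT := fun x y : T => (x < y)%O)) => //.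
  - by move=> x y z; exact: lt_trans.
  - exact: srt.
  - exact: srt.
  - move=> x; apply/mapP/mapP => -[a _ ->].
      by have [b ->] := fg a; exists b; rewrite ?mem_enum.
    by have [b ->] := gf a; exists b; rewrite ?mem_enum.
by move/eq_in_map : e => e a; apply: e; rewrite mem_enum.
Qed.

Lemma cell_values_inj r (l : 'I_r -> nat) n (i i' : {ffun 'I_r -> 'I_n.+1}) :
  (forall j, (1 <= l j)%N) -> increasing_cells i -> increasing_cells i' ->
  (forall c, (c < n.+1)%N -> cell_values l i c = cell_values l i' c) -> i = i'.
Proof.
move=> l1 hi hi' e; apply/ffunP.
have h (u u' : {ffun 'I_r -> 'I_n.+1}) : increasing_cells u ->
    (forall c, (c < n.+1)%N -> cell_values l u c = cell_values l u' c) ->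
    forall a, exists b, u a = u' b.
  move=> hu uu a.
  have : cell_values l u' (u a) != 0%N.
    by rewrite -uu// cell_values_in// -lt0n.
  by move=> /cell_values_neq0[b ub]; exists b; exact/val_inj/esym.
apply: (@increasing_eq _ 'I_n.+1) => //.
- exact: h.
- by apply: h => // c cn; rewrite e.
Qed.

End Grid.

(** * Jumps seen through a fine grid *)

Section Discretization.
Context {R : realType}.
Context (t : R) (r : nat) (l : 'I_r -> nat).
Context (t0 : 0 < t).
Context (l1 : forall j, (1 <= l j)%N).

Definition cell_pattern (f : R -> nat) n (i : {ffun 'I_r -> 'I_n.+1}) : Prop :=
  forall c, (c < n.+1)%N ->
    (f (grid t n c.+1) - f (grid t n c))%N = cell_values l i c.

(** The left end of a cell is strictly to the left of every point of the cell, so the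
    strict inequality still holds for a jump at time [x j] exactly. *)
Definition left_below n (x : 'I_r -> \bar R) (i : {ffun 'I_r -> 'I_n.+1}) : Prop :=
  forall j, ((grid t n (i j))%:E < x j)%E.

Definition in_cells n (i : {ffun 'I_r -> 'I_n.+1}) : set (r.-tuple (measurableTypeR R)) :=
  [set v | forall j, in_cell t n (i j) (tnth v j)].

Let grid_lt n c : grid t n c <= grid t n c.+1.
Proof. by apply: grid_le => //; exact: ltW. Qed.

Lemma jumps_cell_pattern f n (i : {ffun 'I_r -> 'I_n.+1}) (tau : r.-tuple R) :
  counting_path f -> increasing_cells i -> jumps_are f t l tau -> in_cells i tau ->
  cell_pattern f i.
Proof.
move=> pf hi [tau_lt tau_in tau_l tau_all] itau c cn.
have g0 : 0 <= grid t n c by rewrite grid_ge0// ltW.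
have [[j ij]|nj] := pselect (exists j, i j = c :> nat).
  rewrite -ij cell_values_in//; apply/eqP; rewrite -(eqr_nat R) -tau_l ij.
  have tc : in_cell t n c (tnth tau j) by rewrite -ij; exact: itau.
  rewrite (path_single_jump pf g0 tc)// => u uc ju.
  have ut : 0 < u <= t by apply: (@in_cell_bound _ t n (Ordinal cn)) => //; exact: ltW.
  have [k uk] := tau_all u ut ju; rewrite uk; congr tnth.
  apply: (increasing_cells_inj hi); apply: val_inj => /=; rewrite ij.
  by apply: (@in_cell_inj _ t n _ _ u); [exact: ltW|rewrite uk; exact: itau|].
rewrite cell_values_out; last by move=> j; apply: contra_notN nj => /eqP; exists j.
rewrite (path_no_jump pf g0 (grid_lt n c)) ?subnn// => u uc.
apply/eqP/negP => /negP ju.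
have ut : 0 < u <= t by apply: (@in_cell_bound _ t n (Ordinal cn)) => //; exact: ltW.
have [k uk] := tau_all u ut ju; apply: nj; exists k.
by apply: (@in_cell_inj _ t n _ _ u); [exact: ltW|rewrite uk; exact: itau|].
Qed.

(** The mesh leaves room for one jump per cell, which then accounts for the whole
    increment over the cell. *)
Lemma cell_pattern_jumps f n (i : {ffun 'I_r -> 'I_n.+1}) :
  counting_path f -> increasing_cells i ->
  (forall s s', 0 < s <= t -> 0 < s' <= t -> jump_height f s != 0 ->
     jump_height f s' != 0 -> s < s' -> t / n.+1%:R <= s' - s) ->
  cell_pattern f i ->
  exists2 tau : r.-tuple R, in_cells i tau & jumps_are f t l tau.
Proof.
move=> pf hi sep pat; have t0' := ltW t0.
have sep1 c s s' : (c < n.+1)%N -> in_cell t n c s -> in_cell t n c s' ->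
    jump_height f s != 0 -> jump_height f s' != 0 -> s = s'.
  move=> cn sc sc' js js'.
  have st : 0 < s <= t by exact: (@in_cell_bound _ t n (Ordinal cn)).
  have st' : 0 < s' <= t by exact: (@in_cell_bound _ t n (Ordinal cn)).
  have [ss|ss|//] := ltgtP s s'.
    by have := sep s s' st st' js js' ss; rewrite leNgt (in_cell_dist sc sc').
  by have := sep s' s st' st js' js ss; rewrite leNgt (in_cell_dist sc' sc).
have ex j : exists s, in_cell t n (i j) s /\ jump_height f s != 0.
  have g0 := grid_ge0 n (i j) t0'.
  have h : (f (grid t n (i j)) < f (grid t n (i j).+1))%N.
    by rewrite -subn_gt0 pat// cell_values_in// (leq_trans _ (l1 j)).
  by have [s [sc js _ _]] := path_first_jump pf g0 (grid_lt n _) h; exists s.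
have [tau htau] := choice ex.
have tauE j : tnth (mktuple tau) j = tau j by rewrite tnth_mktuple.
exists (mktuple tau); first by move=> j; rewrite tauE; have [] := htau j.
split.
- move=> a b ab; rewrite !tauE; have [ha _] := htau a; have [hb _] := htau b.
  exact: in_cell_lt (hi _ _ ab) ha hb.
- by move=> j; rewrite tauE; have [h _] := htau j; exact: in_cell_bound h.
- move=> j; rewrite tauE; have [h jj] := htau j.
  rewrite (path_single_jump pf (grid_ge0 n (i j) t0') h) ?pat ?cell_values_in//.
  by move=> u uc ju; exact: (sep1 (i j)).
- move=> s st js; have [c sc] := in_cell_exists n st.
  have : cell_values l i c != 0%N.
    rewrite -pat//; apply: contraNneq (js) => e.
    rewrite (path_single_jump pf (grid_ge0 n c t0') sc) ?e// => u uc ju.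
    exact: (sep1 c).
  move=> /cell_values_neq0[j ij]; exists j; rewrite tauE; have [h jj] := htau j.
  by apply: (sep1 c) => //; rewrite -ij.
Qed.

(** On a grid that is fine enough for the path, the increments over the cells show
    exactly the jumps. *)
Lemma jumps_near_cell_pattern f (x : 'I_r -> \bar R) : counting_path f ->
  \forall n \near \oo,
    (exists i : {ffun 'I_r -> 'I_n.+1},
       [/\ increasing_cells i, left_below x i & cell_pattern f i]) <->
    (exists2 tau, orthant x tau & jumps_are f t l tau).
Proof.
move=> pf; have t0' := ltW t0.
have [L HL] := path_jumps_finite pf t0'.
have [e e0 [he1 he2]] := mesh_bound L x.
near=> n.
have ne : t / n.+1%:R < e by near: n; exact: near_mesh.
split=> [[i [hi xi pat]]|[tau xtau jtau]].
  have [|tau itau jtau] := @cell_pattern_jumps f n i pf hi _ pat.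
    move=> s s' st st' js js' ss; apply: (le_trans (ltW ne)).
    by apply: he1 => //; exact: HL.
  exists tau => // j; apply: (he2 _ j (grid t n (i j))) => //.
    have [_ tin tl _] := jtau; apply: HL => //.
    by rewrite tl pnatr_eq0 -lt0n (leq_trans _ (l1 j)).
  by apply: le_lt_trans ne; apply: in_cell_near; exact: itau.
have [tlt tin tl tall] := jtau.
have [i hi] := choice (fun j => in_cell_exists n (tin j)).
have inc : increasing_cells [ffun j => i j].
  move=> a b ab; rewrite !ffunE ltn_neqAle.
  rewrite (in_cell_le t0' (ltW (tlt a b ab)) (hi a) (hi b)) andbT.
  apply/eqP => eab; have := tlt a b ab.
  have tL j : tnth tau j \in L.
    by apply: HL => //; rewrite tl pnatr_eq0 -lt0n (leq_trans _ (l1 j)).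
  move=> /(he1 _ _ (tL a) (tL b)); rewrite leNgt => /negP; apply.
  apply: lt_trans ne; apply: in_cell_dist (hi b).
  by rewrite -eab; exact: hi.
have itau : in_cells [ffun j => i j] tau by move=> j; rewrite ffunE.
exists [ffun j => i j]; split => //; last exact: jumps_cell_pattern itau.
move=> j; rewrite ffunE; apply: lt_le_trans (xtau j).
by rewrite lte_fin; have /andP[] := hi j.
Unshelve. all: by end_near. Qed.

(** A path may well jump at time [t] itself. *)
Definition closed_simplex : set (r.-tuple (measurableTypeR R)) :=
  [set v | (forall a b : 'I_r, (a < b)%N -> tnth v a < tnth v b) /\
           (forall j, 0 < tnth v j <= t)].

(** The counterpart of [jumps_near_cell_pattern] for the tuples of times, whose volume
    is to be compared with the probability of the paths. *)
Lemma tuple_near_cells (x : 'I_r -> \bar R) (v : r.-tuple (measurableTypeR R)) :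
  \forall n \near \oo,
    (exists i : {ffun 'I_r -> 'I_n.+1},
       [/\ increasing_cells i, left_below x i & in_cells i v]) <->
    (orthant x `&` closed_simplex) v.
Proof.
have t0' := ltW t0; pose L : seq R := v.
have vL j : tnth v j \in L by exact: mem_tnth.
have [e e0 [he1 he2]] := mesh_bound L x.
near=> n.
have ne : t / n.+1%:R < e by near: n; exact: near_mesh.
split=> [[i [hi xi iv]]|[xv [vlt vin]]].
  split=> [j|].
    apply: (he2 _ j (grid t n (i j))) => //.
    by apply: le_lt_trans ne; apply: in_cell_near; exact: iv.
  split=> [a b ab|j]; last exact: in_cell_bound (iv j).
  exact: in_cell_lt (hi _ _ ab) (iv a) (iv b).
have [i hi] := choice (fun j => in_cell_exists n (vin j)).
exists [ffun j => i j]; split=> [a b ab|j|j]; rewrite !ffunE//.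
  rewrite ltn_neqAle (in_cell_le t0' (ltW (vlt a b ab)) (hi a) (hi b)) andbT.
  apply/eqP => eab; have := vlt a b ab.
  move=> /(he1 _ _ (vL a) (vL b)); rewrite leNgt => /negP; apply.
  by apply: lt_trans ne; apply: in_cell_dist (hi b); rewrite -eab; exact: hi.
by apply: lt_le_trans (xv j); rewrite lte_fin; have /andP[] := hi j.
Unshelve. all: by end_near. Qed.

Lemma cell_pattern_total f n (i : {ffun 'I_r -> 'I_n.+1}) :
  counting_path f -> f 0 = 0%N -> cell_pattern f i -> f t = (\sum_(j < r) l j)%N.
Proof.
move=> pf f0 pat; have t0' := ltW t0.
have h c : (c <= n.+1)%N -> f (grid t n c) = (\sum_(0 <= k < c) cell_values l i k)%N.
  elim: c => [|c IH] cn; first by rewrite big_nil grid0.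
  rewrite big_nat_recr//= -IH ?(ltnW cn)// -pat// subnKC//.
  by apply: (proj1 pf); [exact: grid_ge0|exact: grid_lt].
rewrite -{1}(grid_last t n) h// big_mkord /cell_values.
rewrite (exchange_big_dep xpredT)//=; apply: eq_bigr => j _.
by rewrite (big_pred1 (i j))// => k; rewrite eq_sym.
Qed.

Lemma jumps_are_total f (tau : r.-tuple R) :
  counting_path f -> f 0 = 0%N -> jumps_are f t l tau -> f t = (\sum_(j < r) l j)%N.
Proof.
move=> pf f0 jtau.
have [n _ hn] := jumps_near_cell_pattern (fun=> +oo%E) pf.
have [_ []] := hn n (leqnn n).
  by exists tau => // j; rewrite leey.
by move=> i [_ _]; exact: cell_pattern_total.
Qed.

Lemma jumps_are_unique f (tau tau' : r.-tuple R) :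
  jumps_are f t l tau -> jumps_are f t l tau' -> tau = tau'.
Proof.
move=> [lt1 in1 l1' all1] [lt2 in2 l2' all2]; apply: eq_from_tnth.
apply: increasing_eq => // a.
- by apply: all2 => //; rewrite l1' pnatr_eq0 -lt0n (leq_trans _ (l1 a)).
- by apply: all1 => //; rewrite l2' pnatr_eq0 -lt0n (leq_trans _ (l1 a)).
Qed.

End Discretization.

(** * State probabilities over one cell *)

Lemma cvg_expR_comp (R : realType) (u : R^nat) (x : R) :
  u n @[n --> \oo] --> x -> expR (u n) @[n --> \oo] --> expR x.
Proof. by move=> ux; apply: (cvg_comp u expR ux); exact: continuous_expR. Qed.

(** Use [1 + a <= exp a] and, from the same bound at [- a / (1 + a)],
    [exp (a / (1 + a)) <= 1 + a]. *)
Lemma cvg_pow_expR (R : realType) (a : R^nat) (x : R) :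
  (n.+1%:R * a n) @[n --> \oo] --> x ->
  ((1 + a n) ^+ n.+1) @[n --> \oo] --> expR x.
Proof.
move=> ax.
have a0 : a n @[n --> \oo] --> (0 : R).
  have -> : a = fun n => harmonic n * (n.+1%:R * a n).
    by apply/funext => n; rewrite /harmonic mulKf// pnatr_eq0.
  by rewrite -[X in _ --> X](mul0r x); apply: cvgM => //; exact: cvg_harmonic.
have lo : expR ((1 + a n)^-1 * (n.+1%:R * a n)) @[n --> \oo] --> expR x.
  apply: cvg_expR_comp; rewrite -[X in _ --> X]mul1r; apply: cvgM => //.
  rewrite -[X in _ --> X]invr1; apply: cvgV; first exact: oner_neq0.
  by rewrite -[X in _ --> X]addr0; apply: cvgD => //; exact: cvg_cst.
have hi : expR (n.+1%:R * a n) @[n --> \oo] --> expR x.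
  exact: cvg_expR_comp.
apply: squeeze_cvgr lo hi; near=> n.
have an : `|a n| < 2^-1.
  by near: n; move/cvgr0Pnorm_lt : a0; apply; rewrite invr_gt0.
have pos : 0 < 1 + a n by move: an; rewrite ltr_norml => /andP[h _]; lra.
apply/andP; split; last first.
  by rewrite mulrC expRM_natr lerXn2r ?nnegrE ?expR_ge0 ?(ltW pos)// expR_ge1Dx.
have -> : (1 + a n)^-1 * (n.+1%:R * a n) = ((1 + a n)^-1 * a n) * n.+1%:R by ring.
rewrite expRM_natr lerXn2r ?nnegrE ?expR_ge0 ?(ltW pos)//.
have h := expR_ge1Dx (- ((1 + a n)^-1 * a n)).
have e : 1 - (1 + a n)^-1 * a n = (1 + a n)^-1 by field; rewrite gt_eqF.
rewrite e expRN in h.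
by rewrite -[leLHS]invrK -[leRHS]invrK lef_pV2 ?posrE ?invr_gt0// expR_gt0.
Unshelve. all: by end_near. Qed.

Section ProcessLaw.
Context (R : realType) (alpha lambda : R) (d : measure_display) (Omega : measurableType d).
Context (P : probability Omega R) (N : R -> Omega -> nat).
Context (lambda0 : 0 < lambda).
Context (alpha01 : 0 < alpha < 1).
Context (NP : space_fractional_poisson P alpha lambda N).
Local Notation m := (lambda `^ alpha).

Lemma process_path w : counting_path (fun s => N s w).
Proof.
split=> [s t s0 st|t t0]; first exact: (sfp_nondecreasing NP).
exact: (sfp_right_continuous NP).
Qed.

Lemma measurable_incr (s t : R) (B : set nat) : 0 <= s -> s <= t ->
  measurable [set w | B (incr N s t w)].
Proof.
move=> s0 st; have mN u k : 0 <= u -> measurable [set w | N u w = k].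
  move=> u0; have mk : measurable [set k] by [].
    by rewrite -[X in measurable X]setTI; exact: (sfp_measurable NP u0 measurableT mk).
have -> : [set w | B (incr N s t w)] =
    \bigcup_a \bigcup_(b in [set b | B (b - a)%N]) ([set w | N s w = a] `&` [set w | N t w = b]).
  apply/seteqP; split=> w /=.
    by move=> h; exists (N s w) => //; exists (N t w).
  by move=> [a _ [b hb [/= sa tb]]]; rewrite /incr sa tb.
apply: bigcupT_measurable => a; apply: bigcup_measurable => b _.
by apply: measurableI; apply: mN => //; exact: le_trans st.
Qed.

Definition state_prob (t : R) (k : nat) : R := fine (P [set w | N t w = k]).

Lemma incr0 t w : incr N 0 t w = N t w.
Proof. by rewrite /incr (sfp_start NP) subn0. Qed.

Lemma measurable_state t (B : set nat) : 0 <= t -> measurable [set w | B (N t w)].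
Proof.
move=> t0; have := measurable_incr B (lexx 0) t0.
by under eq_set do rewrite incr0.
Qed.

Lemma state_probE t k : 0 <= t -> P [set w | N t w = k] = (state_prob t k)%:E.
Proof.
move=> t0; rewrite fineK// fin_num_measure//.
exact: (@measurable_state t [set k]).
Qed.

Lemma incr_prob (s h : R) k : 0 <= s -> 0 <= h ->
  P [set w | incr N s (s + h) w = k] = (state_prob h k)%:E.
Proof.
move=> s0 h0; transitivity (P [set w | incr N 0 h w = k]).
  exact: (@sfp_stationary _ _ _ _ _ _ _ NP s h [set k] s0 h0).
by under eq_set do rewrite incr0; exact: state_probE.
Qed.

Lemma cells_prob t n (v : nat -> nat) : 0 < t ->
  P [set w | forall c, (c < n.+1)%N -> incr N (grid t n c) (grid t n c.+1) w = v c] =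
  (\prod_(c < n.+1) state_prob (t / n.+1%:R) (v c))%:E.
Proof.
move=> t0; transitivity (\prod_(c < n.+1) P [set w | incr N (grid t n c) (grid t n c.+1) w = v c])%E.
  apply: (@sfp_independent _ _ _ _ _ _ _ NP n.+1 (grid t n) (fun c => [set v c])).
    by rewrite grid0.
  by move=> c _; apply: grid_le => //; exact: ltW.
rewrite -prodEFin; apply: eq_bigr => c _; rewrite gridS incr_prob//.
  by rewrite grid_ge0// ltW.
by rewrite ltW// divr_gt0.
Qed.

Lemma measurable_cells t n (v : nat -> nat) : 0 < t ->
  measurable [set w | forall c, (c < n.+1)%N -> incr N (grid t n c) (grid t n c.+1) w = v c].
Proof.
move=> t0; have -> : [set w | forall c, (c < n.+1)%N -> incr N (grid t n c) (grid t n c.+1) w = v c] =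
  \bigcap_(c in [set c | (c < n.+1)%N]) [set w | incr N (grid t n c) (grid t n c.+1) w = v c].
  by apply/seteqP; split=> w /= h c; exact: h.
apply: bigcap_measurableType => c _.
apply: (@measurable_incr _ _ [set v c]); first by rewrite grid_ge0// ltW.
by apply: grid_le => //; exact: ltW.
Qed.

Lemma incr0_prob (h : R) k : fine (P [set w | incr N 0 h w = k]) = state_prob h k.
Proof. by congr (fine (P _)); apply/seteqP; split=> w /=; rewrite incr0. Qed.

Lemma near_right_ratio (g : R -> R) (q : R) :
  (fun h : R => g h - h * q) =o_ (0^'+) (fun h : R => h) ->
  g h / h @[h --> 0^'+] --> q.
Proof.
move=> /eqoP go; apply/cvgrPdist_le => e e0; near=> h.
have h0 : 0 < h by near: h; exact: nbhs_right_gt.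
have hh : `|g h - h * q| <= e * `|h| by near: h; exact: go.
have -> : q - g h / h = - (g h - h * q) / h by field; rewrite gt_eqF.
rewrite (gtr0_norm h0) in hh.
by rewrite normrM normrN normfV (gtr0_norm h0) ler_pdivrMr.
Unshelve. all: by end_near. Qed.

Lemma cvg_mesh_ratio (g : R -> R) (q t : R) : 0 < t -> g h / h @[h --> 0^'+] --> q ->
  g (t / n.+1%:R) / (t / n.+1%:R) @[n --> \oo] --> q.
Proof.
move=> t0 /cvg_at_rightP; apply; split => [n|]; first by rewrite divr_gt0.
rewrite -[X in _ --> X](mulr0 t); apply: cvgMl_tmp; exact: cvg_harmonic.
Qed.

Lemma cvg_state_prob t k : 0 < t -> (0 < k)%N ->
  state_prob (t / n.+1%:R) k / (t / n.+1%:R) @[n --> \oo] --> jump_rate alpha lambda k.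
Proof.
move=> t0 k0; apply: (@cvg_mesh_ratio (fun h => state_prob h k)) => //.
apply: (@near_right_ratio (fun h => state_prob h k)).
have := sfp_jump NP (lexx 0) k0 => /eqoP ho; apply/eqoP => e e0.
by have := ho e e0; apply: filterS => h; rewrite add0r incr0_prob.
Qed.

Lemma state_prob0_pow t n : 0 < t -> state_prob t 0 = state_prob (t / n.+1%:R) 0 ^+ n.+1.
Proof.
move=> t0; apply: EFin_inj; rewrite -state_probE ?(ltW t0)//.
have := @cells_prob t n (fun=> 0%N) t0; rewrite prodr_const card_ord => <-; congr (P _).
(* the pattern with no selected cell: [r = 0] *)
have pat0 w : cell_pattern t (fun=> 1%N : nat) (fun s => N s w) (finfun (fun _ : 'I_0 => @ord0 n)) <->
    (forall c, (c < n.+1)%N -> incr N (grid t n c) (grid t n c.+1) w = 0%N).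
  by split=> h c cn; have := h c cn; rewrite /cell_values big_ord0.
apply/seteqP; split=> w /=.
  move=> Nt; apply/pat0 => c cn; rewrite /cell_values big_ord0.
  have h u : 0 <= u -> u <= t -> N u w = 0%N.
    by move=> u0 ut; apply/eqP; rewrite -leqn0 -Nt (sfp_nondecreasing NP).
  have t0' := ltW t0; rewrite !h ?grid_ge0//.
  - by rewrite -[leRHS](grid_last t n) grid_le// ltnW.
  - by rewrite -[leRHS](grid_last t n) grid_le.
by move=> /pat0 /(cell_pattern_total t0 (process_path w) (sfp_start NP w)); rewrite big_ord0.
Qed.

(** By [state_prob0_pow], [state_prob t 0] is for every [n] the power of exponent [n + 1]
    of a number of the form [1 - m t / (n + 1) + o(1 / n)]. *)
Lemma state_prob0 t : 0 < t -> state_prob t 0 = expR (- (m * t)).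
Proof.
move=> t0.
have lim : (1 + (state_prob (t / n.+1%:R) 0 - 1)) ^+ n.+1 @[n --> \oo] --> expR (- (m * t)).
  apply: cvg_pow_expR.
  have h : (1 - state_prob h 0) / h @[h --> 0^'+] --> m.
    apply: (@near_right_ratio (fun h => 1 - state_prob h 0)); have := sfp_no_jump NP (lexx 0).
    rewrite levy_integral_total// => /eqoP ho; apply/eqoP => e e0.
    have := ho e e0; apply: filterS => h; rewrite add0r incr0_prob distrC.
    by apply: le_trans; rewrite le_eqVlt; apply/orP; left; apply/eqP; congr (`|_|); ring.
  have {}h := @cvg_mesh_ratio (fun h => 1 - state_prob h 0) _ _ t0 h.
  have e n : n.+1%:R * (state_prob (t / n.+1%:R) 0 - 1) =
      (1 - state_prob (t / n.+1%:R) 0) / (t / n.+1%:R) * - t.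
    have n0 : n.+1%:R != 0 :> R by rewrite pnatr_eq0.
    by move: n.+1%:R (state_prob _ _) n0 => x y x0; field; rewrite x0 gt_eqF.
  under eq_fun do rewrite e.
  by rewrite -mulrN; apply: cvgMr_tmp.
have := cvg_lim (@Rhausdorff R) lim => <-.
apply/esym/cvg_lim => //; apply: cvg_near_cst; near=> n.
by rewrite addrC subrK -state_prob0_pow.
Unshelve. all: by end_near. Qed.

Lemma state_prob0_gt0 t : 0 < t -> 0 < state_prob t 0.
Proof. by move=> t0; rewrite state_prob0// expR_gt0. Qed.

Lemma cvg_state_prob0 t : 0 < t -> state_prob (t / n.+1%:R) 0 @[n --> \oo] --> (1 : R).
Proof.
move=> t0; have e n : state_prob (t / n.+1%:R) 0 = expR (- (m * (t / n.+1%:R))).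
  by rewrite state_prob0// divr_gt0.
rewrite (funext e).
rewrite -[X in _ --> X]expR0; apply: cvg_expR_comp.
rewrite -[X in _ --> X]oppr0; apply: cvgN; rewrite -[X in _ --> X](mulr0 m).
apply: cvgMl_tmp; rewrite -[X in _ --> X](mulr0 t); apply: cvgMl_tmp; exact: cvg_harmonic.
Qed.

(** The odds of an increment [k] against no jump in one cell, per unit of time. *)
Definition cell_odds t n (k : nat) : R :=
  state_prob (t / n.+1%:R) k / state_prob (t / n.+1%:R) 0 / (t / n.+1%:R).

Lemma cvg_cell_odds t k : 0 < t -> (0 < k)%N ->
  cell_odds t n k @[n --> \oo] --> m * sibuya alpha k.
Proof.
move=> t0 k0; rewrite -jump_rateE//.
have e n : cell_odds t n k = state_prob (t / n.+1%:R) k / (t / n.+1%:R) *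
   (state_prob (t / n.+1%:R) 0)^-1.
  by rewrite /cell_odds mulrAC.
rewrite (funext e).
rewrite -[X in _ --> X]mulr1; apply: cvgM; first exact: cvg_state_prob.
rewrite -[X in _ --> X]invr1; apply: cvgV; first exact: oner_neq0.
exact: cvg_state_prob0.
Qed.

End ProcessLaw.

(** * Law of the jump times *)

Lemma measurable_pointwise_limit d (T : measurableType d) (A_ : (set T)^nat) (A : set T) :
  (forall n, measurable (A_ n)) -> (forall x, \forall n \near \oo, A_ n x <-> A x) ->
  measurable A.
Proof.
move=> mA cA.
have -> : A = \bigcup_k \bigcap_(n in [set n | (k <= n)%N]) A_ n.
  apply/seteqP; split=> x.
    move=> Ax; have [k _ hk] := cA x; exists k => // n kn.
    exact: (hk n kn).2.
  move=> [k _ hk]; have [k' _ hk'] := cA x.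
  by apply/(hk' (maxn k k')); [rewrite /= leq_maxr|apply: hk; rewrite /= leq_maxl].
by apply: bigcupT_measurable => k; apply: bigcap_measurableType => n _; exact: mA.
Qed.

Section JumpLaw.
Context (R : realType) (alpha lambda : R) (d : measure_display) (Omega : measurableType d).
Context (P : probability Omega R) (N : R -> Omega -> nat).
Context (lambda0 : 0 < lambda).
Context (alpha01 : 0 < alpha < 1).
Context (NP : space_fractional_poisson P alpha lambda N).
Context (t : R) (r : nat) (l : 'I_r -> nat).
Context (t0 : 0 < t).
Context (l1 : forall j, (1 <= l j)%N).
Local Notation m := (lambda `^ alpha).
Local Notation tupR := (r.-tuple (measurableTypeR R)).

Let path w : counting_path (fun s => N s w) := process_path NP w.

Definition pattern_event n (i : {ffun 'I_r -> 'I_n.+1}) : set Omega :=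
  [set w | cell_pattern t l (fun s => N s w) i].

Definition cell_weight n : R := expR (- (m * t)) * \prod_(j < r) cell_odds P N t n (l j).

(** The factor [exp (- (m * t))] is the probability that all cells are empty; each of
    the [r] jumps replaces an empty cell, hence contributes its odds. *)
Lemma pattern_event_prob n (i : {ffun 'I_r -> 'I_n.+1}) : increasing_cells i ->
  P (pattern_event i) = (cell_weight n * (t / n.+1%:R) ^+ r)%:E.
Proof.
move=> hi; rewrite /pattern_event (cells_prob NP n (cell_values l i) t0); congr EFin.
set h := t / n.+1%:R; have h0 : 0 < h by rewrite divr_gt0.
set p0 := state_prob P N h 0.
have p00 : p0 != 0 by rewrite gt_eqF// (state_prob0_gt0 lambda0 alpha01 NP).
have -> : \prod_(c < n.+1) state_prob P N h (cell_values l i c) =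
    p0 ^+ n.+1 * \prod_(c < n.+1) (state_prob P N h (cell_values l i c) / p0).
  rewrite -[X in p0 ^+ X](card_ord n.+1) -prodr_const -big_split /=.
  by apply: eq_bigr => c _; rewrite mulrCA mulfV// mulr1.
rewrite -(state_prob0_pow NP)// (state_prob0 lambda0 alpha01 NP)// -/m -mulrA; congr (_ * _).
rewrite (bigID (mem (i @: predT)))/= [X in _ * X]big1 ?mulr1; last first.
  move=> c ci; rewrite cell_values_out ?mulfV// => j.
  by apply: contra ci => /eqP/val_inj <-; exact: imset_f.
rewrite big_imset/=; last by move=> a b _ _; exact: increasing_cells_inj.
rewrite -[X in _ ^+ X](card_ord r) -prodr_const -big_split /=.
apply: eq_bigr => j _; rewrite cell_values_in// /cell_odds -/h -/p0.
by rewrite divfK// gt_eqF.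
Qed.

Lemma measurable_pattern_event n (i : {ffun 'I_r -> 'I_n.+1}) : measurable (pattern_event i).
Proof. exact: (measurable_cells NP n (cell_values l i) t0). Qed.

Let in_cellsE n (i : {ffun 'I_r -> 'I_n.+1}) : in_cells t i =
  [set v : tupR | forall j, `]grid t n (i j), grid t n (i j).+1]%classic (tnth v j)].
Proof. by apply/seteqP; split=> v h j; have := h j; rewrite /= in_itv. Qed.

Lemma measurable_in_cells n (i : {ffun 'I_r -> 'I_n.+1}) : measurable (in_cells t i).
Proof.
rewrite in_cellsE; apply: (@measurable_tuple_box R r
  (fun j => `]grid t n (i j), grid t n (i j).+1]%classic)) => j.
exact: measurable_itv.
Qed.

Lemma tuple_volume_in_cells n (i : {ffun 'I_r -> 'I_n.+1}) :
  tuple_volume (in_cells t i) = ((t / n.+1%:R) ^+ r)%:E.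
Proof.
have muE j : lebesgue_measure (`]grid t n (i j), grid t n (i j).+1]%classic : set R) =
    (t / n.+1%:R)%:E.
  rewrite lebesgue_measure_itv/= lte_fin gridS ltrDl divr_gt0//.
  by rewrite -EFinB addrC addKr.
rewrite in_cellsE (@tuple_volume_box R r
  (fun j => `]grid t n (i j), grid t n (i j).+1]%classic)); last 2 first.
- by move=> j; exact: measurable_itv.
- by move=> j; rewrite muE ltry.
congr EFin; under eq_bigr do rewrite muE /=.
by rewrite prodr_const card_ord.
Qed.

Let selected n (x : 'I_r -> \bar R) : set {ffun 'I_r -> 'I_n.+1} :=
  [set i | increasing_cells i /\ left_below t x i].

Let discrete_event n x : set Omega := \bigcup_(i in @selected n x) pattern_event i.
Let discrete_set n x : set tupR := \bigcup_(i in @selected n x) in_cells t i.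

Let discrete_eventP n x w : discrete_event n x w <->
  exists i : {ffun 'I_r -> 'I_n.+1},
       [/\ increasing_cells i, left_below t x i & cell_pattern t l (fun s => N s w) i].
Proof. by split=> [[i [hi xi] pat]|[i [hi xi pat]]]; exists i. Qed.

Let discrete_setP n x v : discrete_set n x v <->
  exists i : {ffun 'I_r -> 'I_n.+1},
       [/\ increasing_cells i, left_below t x i & in_cells t i v].
Proof. by split=> [[i [hi xi] pat]|[i [hi xi pat]]]; exists i. Qed.

Let measurable_discrete_event n x : measurable (discrete_event n x).
Proof.
apply: fin_bigcup_measurable; first exact: finite_finset.
by move=> i _; exact: measurable_pattern_event.
Qed.

Let measurable_discrete_set n x : measurable (discrete_set n x).
Proof.
apply: fin_bigcup_measurable; first exact: finite_finset.
by move=> i _; exact: measurable_in_cells.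
Qed.

(** Cell by cell, the probability of a pattern is proportional to the volume of the
    corresponding product of cells. *)
Let discrete_prob n x :
  P (discrete_event n x) = ((cell_weight n)%:E * tuple_volume (discrete_set n x))%E.
Proof.
rewrite /discrete_event measure_fin_bigcup//; last 3 first.
- exact: finite_finset.
- move=> i i' [hi _] [hi' _] [w [wi wi']].
  by apply: (cell_values_inj l1 hi hi') => c cn; rewrite -wi// -wi'.
- by move=> i _; exact: measurable_pattern_event.
rewrite /discrete_set measure_fin_bigcup//; last 3 first.
- exact: finite_finset.
- move=> i i' _ _ [v [vi vi']]; apply/ffunP => j; apply/val_inj.
  by apply: in_cell_inj (vi j) (vi' j); exact: ltW.
- by move=> i _; exact: measurable_in_cells.
rewrite ge0_mule_fsumr; last by move=> i; exact: measure_ge0.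
apply: eq_fsbigr => i /set_mem[hi _].
by apply: (etrans (pattern_event_prob hi)); rewrite EFinM -(tuple_volume_in_cells i).
Qed.

Definition jump_event (A : set tupR) : set Omega :=
  [set w | exists2 tau : r.-tuple R, A tau & jumps_are (fun s => N s w) t l tau].

Let near_event x w : \forall n \near \oo, discrete_event n x w <-> jump_event (orthant x) w.
Proof.
have := jumps_near_cell_pattern t0 l1 x (path w); apply: filterS => n h.
by split=> [/discrete_eventP/h//|/h/discrete_eventP].
Qed.

Let near_set x v : \forall n \near \oo,
  discrete_set n x v <-> (orthant x `&` closed_simplex (r := r) t) v.
Proof.
have := tuple_near_cells t0 x v; apply: filterS => n h.
by split=> [/discrete_setP/h//|/h/discrete_setP].
Qed.

Let measurable_orthant_simplex x : measurable (orthant x `&` closed_simplex (r := r) t).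
Proof. exact: (measurable_pointwise_limit (fun n => measurable_discrete_set n x) (near_set x)). Qed.

Lemma measurable_closed_simplex : measurable (closed_simplex (r := r) t).
Proof.
have := measurable_orthant_simplex (fun=> +oo%E).
have -> : orthant (fun=> +oo%E) = [set: tupR] by apply/seteqP; split=> v // _ j; rewrite leey.
by rewrite setTI.
Qed.

Lemma cvg_cell_weight : cell_weight n @[n --> \oo] -->
  expR (- (m * t)) * \prod_(j < r) (m * sibuya alpha (l j)).
Proof.
apply: cvgMl_tmp; apply: cvg_big => [|j _]; last exact: cvg_cell_odds.
exact: mul_continuous.
Qed.

Definition jump_density : R := expR (- (m * t)) * \prod_(j < r) (m * sibuya alpha (l j)).

Lemma jump_density_ge0 : 0 <= jump_density.
Proof.
rewrite mulr_ge0 ?expR_ge0// prodr_ge0// => j _.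
by rewrite mulr_ge0 ?powR_ge0// sibuya_ge0.
Qed.

Let box : set tupR := [set v | forall j, `]0, t]%classic (tnth v j)].

Let measurable_box : measurable box.
Proof. by apply: (@measurable_tuple_box R r (fun=> `]0, t]%classic)) => j; exact: measurable_itv. Qed.

Let box_lty : (tuple_volume box < +oo)%E.
Proof.
rewrite /box (@tuple_volume_box R r (fun=> `]0, t]%classic)) ?ltry// => j.
by rewrite lebesgue_measure_itv/= lte_fin t0 -EFinB ltry.
Qed.

Lemma tuple_volume_simplex_lty (A : set tupR) : measurable A ->
  (tuple_volume (A `&` closed_simplex (r := r) t) < +oo)%E.
Proof.
move=> mA; apply: le_lt_trans box_lty; apply: le_measure; rewrite ?inE//.
- by apply: measurableI => //; exact: measurable_closed_simplex.
- by move=> v [_ [_ hv]] j; rewrite /= in_itv/=; exact: hv.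
Qed.

(** Refining the grid in [discrete_prob], both sides converge by dominated convergence. *)
Lemma orthant_law x : measurable (jump_event (orthant x)) /\
  P (jump_event (orthant x)) =
  (jump_density%:E * tuple_volume (orthant x `&` closed_simplex (r := r) t))%E.
Proof.
have mE : measurable (jump_event (orthant x)).
  exact: (measurable_pointwise_limit (fun n => measurable_discrete_event n x) (near_event x)).
split=> //.
have L : P (discrete_event n x) @[n --> \oo] --> P (jump_event (orthant x)).
  apply: (@cvg_measure_pointwise _ _ _ P setT) => //.
  by rewrite -ge0_fin_numE ?measure_ge0// fin_num_measure.
have V : tuple_volume (discrete_set n x) @[n --> \oo] -->
    tuple_volume (orthant x `&` closed_simplex (r := r) t).
  apply: (@cvg_measure_pointwise _ _ _ (@tuple_volume R r) box) => //.
  move=> n v [i _ iv] j; rewrite /= in_itv/=.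
  by apply: in_cell_bound (iv j); exact: ltW.
have W : (cell_weight n)%:E @[n --> \oo] --> jump_density%:E.
  by apply: cvg_EFin; [exact: nearW|exact: cvg_cell_weight].
have M : ((cell_weight n)%:E * tuple_volume (discrete_set n x))%E @[n --> \oo] -->
    (jump_density%:E * tuple_volume (orthant x `&` closed_simplex (r := r) t))%E.
  apply: cvgeM => //; apply: mule_def_fin => //.
  by rewrite ge0_fin_numE ?measure_ge0// tuple_volume_simplex_lty//; exact: measurable_orthant.
rewrite -(cvg_lim (@ereal_hausdorff R) L) -(cvg_lim (@ereal_hausdorff R) M).
by rewrite (funext (fun n => discrete_prob n x)).
Qed.

Let jump_eventT : jump_event setT = jump_event (orthant (fun=> +oo%E)).
Proof.
by congr jump_event; apply/seteqP; split=> v // _ j; rewrite leey.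
Qed.

(** A path has at most one tuple of jump times ([jumps_are_unique]), so [jump_event]
    respects differences and disjoint unions, and it is enough to know it on orthants. *)
Lemma jump_law (A : set tupR) : measurable A ->
  measurable (jump_event A) /\
  P (jump_event A) = (jump_density%:E * tuple_volume (A `&` closed_simplex (r := r) t))%E.
Proof.
pose Q (A : set tupR) := measurable (jump_event A) /\
  P (jump_event A) = (jump_density%:E * tuple_volume (A `&` closed_simplex (r := r) t))%E.
suff h : forall A, measurable A -> Q A by exact: h.
have [mT PT] : Q setT.
  rewrite /Q jump_eventT; have [h1 h2] := orthant_law (fun=> +oo%E); split=> //; rewrite h2.
  by congr (_ * tuple_volume (_ `&` _))%E; apply/seteqP; split=> v // _ j; rewrite leey.
apply: orthant_induction.
- exact: orthant_law.
- move=> B mB [mEB PB].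
  have e : jump_event (~` B) = jump_event setT `\` jump_event B.
    apply/seteqP; split=> w /=.
      move=> [tau nB jtau]; split; first by exists tau.
      move=> [tau' B' jtau']; apply: nB.
      by rewrite (jumps_are_unique l1 jtau jtau').
    move=> [[tau _ jtau] nB]; exists tau => //= Btau; apply: nB; by exists tau.
  have sub : jump_event B `<=` jump_event setT.
    by move=> w [tau _ jtau]; exists tau.
  split; first by rewrite e; exact: measurableD.
  have fP : (P (jump_event setT) < +oo)%E by rewrite -ge0_fin_numE ?measure_ge0// fin_num_measure.
  have PD : P (jump_event (~` B)) = (P (jump_event setT) - P (jump_event B))%E.
    by rewrite e; apply: etrans (measureD mT mEB fP) _; rewrite (setIidr sub).
  have fS : (tuple_volume (closed_simplex (r := r) t) < +oo)%E.
    by have := tuple_volume_simplex_lty measurableT; rewrite setTI.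
  have VD : tuple_volume (~` B `&` closed_simplex (r := r) t) =
      (tuple_volume (closed_simplex (r := r) t) - tuple_volume (B `&` closed_simplex (r := r) t))%E.
    have -> : ~` B `&` closed_simplex (r := r) t = closed_simplex (r := r) t `\` B by rewrite setIC.
    apply: etrans (measureD measurable_closed_simplex mB fS) _.
    by rewrite setIC.
  rewrite PD PB PT setTI VD muleBr//.
  apply: fin_num_adde_defr; by rewrite ge0_fin_numE ?measure_ge0.
- move=> F mF tF QF.
  have e : jump_event (\bigcup_n F n) = \bigcup_n jump_event (F n).
    apply/seteqP; split=> w /=.
      by move=> [tau [n _ Fn] jtau]; exists n => //; exists tau.
    by move=> [n _ [tau Fn jtau]]; exists tau => //; exists n.
  have mU : measurable (\bigcup_n jump_event (F n)).
    by apply: bigcupT_measurable => n; have [] := QF n.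
  split; first by rewrite e.
  have PU : P (jump_event (\bigcup_n F n)) = (\sum_(n <oo) P (jump_event (F n)))%E.
    rewrite e; apply: measure_semi_bigcup => //.
      by move=> n; have [] := QF n.
    move=> i j _ _ [w [[tau Fi jtau] [tau' Fj jtau']]].
    apply: tF => //; exists tau; split => //.
    by rewrite (jumps_are_unique l1 jtau jtau').
  have mFS n : measurable (F n `&` closed_simplex (r := r) t).
    by apply: measurableI => //; exact: measurable_closed_simplex.
  have VU : tuple_volume ((\bigcup_n F n) `&` closed_simplex (r := r) t) =
      (\sum_(n <oo) tuple_volume (F n `&` closed_simplex (r := r) t))%E.
    rewrite setI_bigcupl; apply: measure_semi_bigcup => //.
      by move=> i j _ _ [v [[Fi _] [Fj _]]]; apply: tF => //; exists v.
    exact: bigcupT_measurable.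
  rewrite PU VU -nneseriesZl; last by move=> n _; exact: measure_ge0.
  by apply: eq_eseriesr => n _; have [] := QF n.
Qed.

End JumpLaw.

(** * Law of the state *)

Lemma cvg_binomial_ratio (R : realType) (k : nat) :
  ('C(n.+1, k)%:R / n.+1%:R ^+ k : R) @[n --> \oo] --> (k`!%:R^-1 : R).
Proof.
elim: k => [|k IH].
  by under eq_fun do rewrite bin0 expr0 divr1; rewrite fact0 invr1; exact: cvg_cst.
have h1 : (1 - k%:R * n.+1%:R^-1 : R) @[n --> \oo] --> (1 : R).
  rewrite -[X in _ --> X]subr0 -[X in _ - X](mulr0 (k%:R : R)).
  apply: cvgB; first exact: cvg_cst.
  by apply: cvgMl_tmp; exact: cvg_harmonic.
have h : 'C(n.+1, k)%:R / n.+1%:R ^+ k * (1 - k%:R * n.+1%:R^-1) / k.+1%:R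
    @[n --> \oo] --> (k`!%:R^-1 * 1 / k.+1%:R : R).
  by apply: cvgMr_tmp; exact: cvgM.
have -> : k.+1`!%:R^-1 = k`!%:R^-1 * 1 / k.+1%:R :> R.
  by rewrite mulr1 factS natrM invfM mulrC.
apply: cvg_trans h; apply: near_eq_cvg; near=> n.
have kn : (k <= n.+1)%N.
  by rewrite leqW//; near: n; exact: nbhs_infty_ge.
have n0 : n.+1%:R != 0 :> R by rewrite pnatr_eq0.
have k0 : k.+1%:R != 0 :> R by rewrite pnatr_eq0.
have e : k.+1%:R * 'C(n.+1, k.+1)%:R = (n.+1%:R - k%:R) * 'C(n.+1, k)%:R :> R.
  by rewrite -natrB// -!natrM mul_bin_left.
have -> : 'C(n.+1, k.+1)%:R = (n.+1%:R - k%:R) * 'C(n.+1, k)%:R / k.+1%:R :> R.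
  by rewrite -e mulrAC mulfV// mul1r.
rewrite exprS; have := expf_neq0 k n0.
move: (n.+1%:R ^+ k : R) (n.+1%:R : R) (k.+1%:R : R) n0 k0 => x y z y0 z0 x0.
by field; rewrite x0 y0 z0.
Unshelve. all: by end_near. Qed.

Lemma cvg_coef_mul (R : realType) (p_ q_ : nat -> {poly R}) (p q : {poly R}) :
  (forall k, (p_ n)`_k @[n --> \oo] --> p`_k) ->
  (forall k, (q_ n)`_k @[n --> \oo] --> q`_k) ->
  forall k, (p_ n * q_ n)`_k @[n --> \oo] --> (p * q)`_k.
Proof.
move=> hp hq k; rewrite coefM.
have -> : (fun n => (p_ n * q_ n)`_k) = fun n => \sum_(j < k.+1) (p_ n)`_j * (q_ n)`_(k - j).
  by apply/funext => n; rewrite coefM.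
by apply: cvg_big => [|j _]; [exact: add_continuous|exact: cvgM].
Qed.

Lemma cvg_coef_exp (R : realType) (p_ : nat -> {poly R}) (p : {poly R}) m :
  (forall k, (p_ n)`_k @[n --> \oo] --> p`_k) ->
  forall k, (p_ n ^+ m)`_k @[n --> \oo] --> (p ^+ m)`_k.
Proof.
move=> hp; elim: m => [|m IH] k.
  rewrite expr0 (_ : (fun n => (p_ n ^+ 0)`_k) = cst (1 : {poly R})`_k); first exact: cvg_cst.
  by apply/funext => n; rewrite expr0.
rewrite exprS (_ : (fun n => (p_ n ^+ m.+1)`_k) = fun n => (p_ n * p_ n ^+ m)`_k).
  exact: cvg_coef_mul.
by apply/funext => n; rewrite exprS.
Qed.

Section StateLaw.
Context (R : realType) (alpha lambda : R) (d : measure_display) (Omega : measurableType d).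
Context (P : probability Omega R) (N : R -> Omega -> nat).
Context (lambda0 : 0 < lambda).
Context (alpha01 : 0 < alpha < 1).
Context (NP : space_fractional_poisson P alpha lambda N).
Local Notation m := (lambda `^ alpha).
Local Notation p := (state_prob P N).

Lemma state_probD (s h : R) k : 0 <= s -> 0 <= h ->
  p (s + h) k = \sum_(j < k.+1) p s j * p h (k - j)%N.
Proof.
move=> s0 h0; have sh : s <= s + h by rewrite lerDl.
pose E j := [set w | N s w = j] `&` [set w | incr N s (s + h) w = (k - j)%N].
have PE j : P (E j) = (p s j * p h (k - j)%N)%:E.
  (* the consecutive intervals ]0, s] and ]s, s + h] *)
  pose g (i : nat) : R := if i is i'.+1 then if i' is 0%N then s else s + h else 0.
  have := @sfp_independent _ _ _ _ _ _ _ NP 2%N g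
    (fun i => [set if i is 0%N then j else (k - j)%N]) (lexx 0).
  rewrite !big_ord_recl big_ord0 /= => H.
  have {H} := H _; rewrite (incr_prob NP)// mule1.
  have -> : P [set w | incr N 0 s w = j] = (p s j)%:E.
    by rewrite -(state_probE NP)//; congr (P _); apply/seteqP; split=> w /=; rewrite (incr0 NP).
  rewrite -EFinM => <-; last by case=> [|[|i]].
  congr (P _); apply/seteqP; split=> w /=.
    move=> [h1 h2] [|[|i]] //= _; by rewrite (incr0 NP).
  by move=> hw; have := hw 0%N isT; have := hw 1%N isT; rewrite /= (incr0 NP).
have mE j : measurable (E j).
  apply: measurableI; first exact: (@measurable_state _ _ _ _ _ _ _ NP s [set j]).
  exact: (measurable_incr NP [set (k - j)%N]).
apply: EFin_inj; rewrite -(state_probE NP) ?addr_ge0//.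
have -> : [set w | N (s + h) w = k] = \bigcup_(j in `I_k.+1) E j.
  apply/seteqP; split=> w /=.
    move=> Nk; exists (N s w); last by rewrite /E /= /incr Nk.
    by rewrite /= ltnS -Nk (sfp_nondecreasing NP).
  move=> [j /= jk [/= Ns]]; rewrite /incr Ns => e.
  have := sfp_nondecreasing NP w s0 sh; rewrite Ns => jN.
  by rewrite -(subnK jN) e subnK.
rewrite measure_fin_bigcup//; last first.
  by move=> i j _ _ [w [[/= <- _] [/= <- _]]].
rewrite -fsbig_ord -sumEFin; apply: eq_bigr => j _; exact: PE.
Qed.

Lemma state_prob_at0 k : p 0 k = (k == 0%N)%:R.
Proof.
rewrite /state_prob; case: eqP => [->|k0].
  have -> : [set w | N 0 w = 0%N] = setT by apply/seteqP; split=> w //= _; exact: sfp_start NP w.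
  by rewrite probability_setT.
have -> : [set w | N 0 w = k] = set0.
  by apply/seteqP; split=> w //=; rewrite (sfp_start NP) => /esym.
by rewrite measure0.
Qed.

Definition state_gf h K : {poly R} := \poly_(j < K.+1) p h j.

(** Increments over equal consecutive intervals are independent and identically
    distributed, so their generating functions multiply. *)
Lemma state_prob_gf (h : R) K c k : 0 <= h -> (k <= K)%N ->
  p (c%:R * h) k = (state_gf h K ^+ c)`_k.
Proof.
move=> h0; elim: c k => [|c IH] k kK.
  by rewrite mul0r state_prob_at0 expr0 coef1.
rewrite -natr1 mulrDl mul1r state_probD ?mulr_ge0// exprSr coefM.
apply: eq_bigr => j _; have jk : (j <= k)%N by rewrite -ltnS.
rewrite IH ?(leq_trans jk)//; congr (_ * _); rewrite coef_poly ltnS.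
by rewrite (leq_trans (leq_subr _ _) kK).
Qed.

(** Over one cell of length [h], the generating function is [p_0 (1 + h W)], where the
    coefficients of [W] converge to the jump rates. As [W] has no constant term, only
    the terms of degree at most [k] in the binomial expansion of [(1 + h W)^(n+1)]
    reach the coefficient of [z^k], and each of them converges. *)
Lemma state_law t k : 0 < t ->
  p t k = expR (- (m * t)) *
    \sum_(j < k.+1) (m * t) ^+ j / j`!%:R * (sibuya_poly alpha k ^+ j)`_k.
Proof.
move=> t0.
pose W n : {poly R} := \poly_(j < k.+1) (if j == 0%N then 0 else cell_odds P N t n j).
have WX n : exists C : {poly R}, W n = C * 'X.
  exists (\poly_(i < k) cell_odds P N t n i.+1); apply/polyP => j.
  by rewrite coefMX !coef_poly; case: j.
have gfE n : state_gf (t / n.+1%:R) k = (p (t / n.+1%:R) 0)%:P * (1 + (t / n.+1%:R)%:P * W n).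
  have h0 : t / n.+1%:R != 0 by rewrite gt_eqF// divr_gt0.
  have p0 : p (t / n.+1%:R) 0 != 0.
    by rewrite gt_eqF// (state_prob0_gt0 lambda0 alpha01 NP)// divr_gt0.
  apply/polyP => j; rewrite coefCM coefD coef1 coefCM !coef_poly.
  case: ltnP => jk; last by case: j jk => // j _; rewrite /= mulr0 addr0 mulr0.
  case: eqP => [->|_]; first by rewrite /= mulr0 addr0 mulr1.
  rewrite /= add0r /cell_odds; move: (t / _) h0 p0 => h h0 p0.
  by field; rewrite p0 h0.
have E n : (k <= n)%N -> p t k = expR (- (m * t)) *
    \sum_(j < k.+1) ('C(n.+1, j)%:R / n.+1%:R ^+ j) * t ^+ j * (W n ^+ j)`_k.
  move=> kn.
  have -> : p t k = p (n.+1%:R * (t / n.+1%:R)) k.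
    by congr p; rewrite mulrC divfK// pnatr_eq0.
  rewrite (@state_prob_gf _ k)//; last by rewrite ltW// divr_gt0.
  rewrite gfE exprMn -polyC_exp -(state_prob0_pow NP)// coefCM.
  rewrite (state_prob0 lambda0 alpha01 NP)//; congr (_ * _).
  rewrite exprDn coef_sum.
  rewrite [RHS](big_ord_widen n.+2
    (fun j => ('C(n.+1, j)%:R / n.+1%:R ^+ j) * t ^+ j * (W n ^+ j)`_k)) ?ltnS ?leqW//.
  rewrite [RHS]big_mkcond /=; apply: eq_bigr => j _.
  rewrite expr1n mul1r coefMn exprMn -polyC_exp coefCM -[LHS]mulr_natl expr_div_n.
  case: ltnP => jk; first by ring.
  by have [C ->] := WX n; rewrite (exprMn _ C) coefMXn jk !mulr0.
have L : expR (- (m * t)) *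
    \sum_(j < k.+1) ('C(n.+1, j)%:R / n.+1%:R ^+ j) * t ^+ j * (W n ^+ j)`_k @[n --> \oo] -->
  expR (- (m * t)) *
    \sum_(j < k.+1) j`!%:R^-1 * t ^+ j * ((m *: sibuya_poly alpha k) ^+ j)`_k.
  apply: cvgMl_tmp; apply: cvg_big => [|j _]; first exact: add_continuous.
  apply: cvgM; first by apply: cvgMr_tmp; exact: cvg_binomial_ratio.
  apply: cvg_coef_exp => i; rewrite coefZ coef_poly.
  have -> : (fun n => (W n)`_i) =
      (fun n => if (i < k.+1)%N then if i == 0%N then 0 else cell_odds P N t n i else 0).
    by apply/funext => n; rewrite coef_poly.
  case: ltnP => ik; last by rewrite mulr0; exact: cvg_cst.
  case: i ik => [|i] ik /=; first by rewrite mulr0; exact: cvg_cst.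
  exact: cvg_cell_odds.
have -> : \sum_(j < k.+1) (m * t) ^+ j / j`!%:R * (sibuya_poly alpha k ^+ j)`_k =
    \sum_(j < k.+1) j`!%:R^-1 * t ^+ j * ((m *: sibuya_poly alpha k) ^+ j)`_k.
  by apply: eq_bigr => j _; rewrite (exprZn m (sibuya_poly alpha k)) coefZ exprMn; ring.
rewrite -(cvg_lim (@Rhausdorff R) L); apply/esym/cvg_lim => //.
apply: cvg_near_cst; near=> n; apply/esym/E.
by near: n; exact: nbhs_infty_ge.
Unshelve. all: by end_near. Qed.

End StateLaw.

(** * Conditional density of the jump times *)

Lemma simplex_closed_simplex (R : realType) (r : nat) (t : R) :
  @simplex R r t `<=` closed_simplex (r := r) t.
Proof. by move=> v [h1 h2]; split=> // j; have /andP[-> /ltW] := h2 j. Qed.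

(** The product of the jump rates, in the shape of the announced density. *)
Lemma prod_jump_rate (R : realType) (alpha c : R) r (l : 'I_r -> nat) :
  0 < alpha < 1 -> (forall j, (1 <= l j)%N) ->
  \prod_(j < r) (c * sibuya alpha (l j)) =
  (c * Gamma (alpha + 1)) ^+ r * (-1) ^+ (\sum_(j < r) l j + r) *
  \prod_(j < r) ((l j)`!%:R * Gamma (alpha + 1 - (l j)%:R))^-1.
Proof.
move=> alpha01 l1.
have -> : (\sum_(j < r) l j + r = \sum_(j < r) (l j).+1)%N.
  rewrite -[X in (_ + X)%N](card_ord r) -sum1_card -big_split /=.
  by apply: eq_bigr => j _; rewrite addn1.
rewrite -[X in _ ^+ X * _](card_ord r) -prodr_const expr_sum -!big_split /=.
by apply: eq_bigr => j _; rewrite sibuya_Gamma//; ring.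
Qed.

Unset Implicit Arguments.
Set Strict Implicit.

Theorem mainTheorem8 (R : realType) (alpha lambda : R)
    (d : measure_display) (Omega : measurableType d) (P : probability Omega R)
    (N : R -> Omega -> nat) :
  0 < lambda -> 0 < alpha < 1 ->
  space_fractional_poisson P alpha lambda N ->
  (forall (k : nat) (t : R), (1 <= k)%N -> 0 <= t ->
     P [set w | N t w = k] =
     (expR (- (lambda `^ alpha * t)) / k`!%:R
      * \sum_(1 <= n < k.+1) state_coef alpha lambda n k * t ^+ n)%:E)
  /\
  (forall (k r : nat) (l : 'I_r -> nat) (t : R),
     (1 <= k)%N -> (1 <= r <= k)%N ->
     (forall j, (1 <= l j)%N) -> (\sum_(j < r) l j)%N = k -> 0 < t ->
     forall A : set (r.-tuple (measurableTypeR R)),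
     measurable A -> A `<=` simplex t ->
     let E := [set w | exists2 tau : r.-tuple R,
                         A tau & jumps_are (fun s => N s w) t l tau] in
     measurable E /\
     (cond_prob P E [set w | N t w = k])%:E =
     iter_integral (fun tau : r.-tuple R =>
       (\1_A tau *
        (k`!%:R * (lambda `^ alpha * Gamma (alpha + 1)) ^+ r * (-1) ^+ (k + r)
         * \prod_(j < r) ((l j)`!%:R * Gamma (alpha + 1 - (l j)%:R))^-1
         / \sum_(1 <= n < k.+1) state_coef alpha lambda n k * t ^+ n))%:E)).
Proof.
move=> lambda0 alpha01 NP.
have f0 (k : nat) : k`!%:R != 0 :> R by rewrite pnatr_eq0 -lt0n fact_gt0.
have law (k : nat) (t : R) : (1 <= k)%N -> 0 <= t -> P [set w | N t w = k] =
     (expR (- (lambda `^ alpha * t)) / k`!%:R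
      * \sum_(1 <= n < k.+1) state_coef alpha lambda n k * t ^+ n)%:E.
  move=> k1; rewrite le_eqVlt => /predU1P[<-|t0].
    rewrite (state_probE NP)// (state_prob_at0 NP) gtn_eqF//; congr EFin.
    rewrite big_nat big1 ?mulr0// => n /andP[n1 _].
    by rewrite expr0n gtn_eqF// mulr0.
  rewrite (state_probE NP) ?(ltW t0)// (state_law lambda0 alpha01 NP)//.
  by rewrite state_sumE// mulrA divfK.
split=> // k r l t k1 rk l1 lk t0 A mA At E.
have [mE PE] := jump_law lambda0 alpha01 NP t0 l1 mA.
split=> //.
have AS : A `&` closed_simplex (r := r) t = A.
  by apply/setIidl; apply: subset_trans At _; exact: simplex_closed_simplex.
have EF : E `&` [set w | N t w = k] = E.
  apply/setIidl => w [tau _ jtau] /=; rewrite -lk.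
  exact: (jumps_are_total t0 l1 (process_path NP w) (sfp_start NP w) jtau).
rewrite AS in PE.
set D := \sum_(1 <= n < k.+1) _ in law *.
have Vfin : tuple_volume A \is a fin_num.
  rewrite ge0_fin_numE ?measure_ge0//.
  by have := tuple_volume_simplex_lty t0 mA; rewrite AS.
have PF := law k t k1 (ltW t0).
have D0 : 0 <= D.
  have : 0 <= fine (P [set w | N t w = k]) by rewrite fine_ge0.
  by rewrite PF /= pmulr_rge0// divr_gt0 ?expR_gt0// ltr0n fact_gt0.
pose C : R := k`!%:R * (lambda `^ alpha * Gamma (alpha + 1)) ^+ r * (-1) ^+ (k + r)
  * \prod_(j < r) ((l j)`!%:R * Gamma (alpha + 1 - (l j)%:R))^-1 / D.
have CE : C = jump_density alpha lambda t l / (expR (- (lambda `^ alpha * t)) / k`!%:R * D).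
  rewrite /C /jump_density prod_jump_rate// lk !invfM invrK.
  move: (expR_eq0 (- (lambda `^ alpha * t))) => /negbT; move: (expR _) D^-1 => e Di e0.
  by field.
have C0 : 0 <= C.
  rewrite CE divr_ge0// ?jump_density_ge0// mulr_ge0// divr_ge0 ?expR_ge0//.
apply: etrans (esym (iter_integral_indic C0 mA)).
rewrite -(fineK Vfin) -EFinM; congr EFin.
by rewrite /cond_prob EF PE PF fineM//= CE mulrAC.
Qed.
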